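(* Let $\mathcal C=\{H_j\}_{j\in J(\mathcal C)}$ be an arrangement of affine hyperplanes in $\mathbb C^k$ having a vertex, with exponents $a:\mathcal C\to\mathbb C$, master function $\Phi$, complement $U$, top-degree flag space $\mathcal F^k(\mathcal C)$, Shapovalov form $S^{(a)}$ and specialization map $v:U\to\mathcal F^k(\mathcal C)$. Then: (i) A point $t\in U$ is a critical point of $\Phi$ if and only if the special vector $v(t)$ is a singular vector, i.e. $\delta_{\mathcal F}^{(a)}v(t)=0$. (ii) If $t\in U$, then $$S^{(a)}(v(t),v(t)) = (-1)^k\,\mathrm{Hess}^{(a)}(t).$$ (iii) If $t^1,t^2\in U$ are different isolated critical points of $\Phi$, then the special singular vectors $v(t^1),v(t^2)$ are orthogonal: $$S^{(a)}(v(t^1),v(t^2)) = 0.$$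
   Context: Arrangement: $\mathcal C=\{H_j\}_{j\in J(\mathcal C)}$ is a finite set of affine hyperplanes in $\mathbb C^k$; $U=\mathbb C^k\setminus\bigcup_j H_j$. A (closed) stratum is a nonempty intersection of hyperplanes of $\mathcal C$ (including $\mathbb C^k$ itself); $l(X)$ is the codimension of the stratum $X$. It is assumed that $\mathcal C$ has a vertex, i.e. a stratum of dimension $0$. Exponents are a map $a:\mathcal C\to\mathbb C$. Orlik–Solomon algebra: $\mathcal A^0(\mathcal C)=\mathbb C$; for $p\ge1$, $\mathcal A^p(\mathcal C)$ is the complex vector space generated by symbols $(H_{i_1},\dots,H_{i_p})$, $H_{i_j}\in\mathcal C$, with relations: the symbol is $0$ if the hyperplanes are not in general position (their intersection is empty or has codimension $<p$); the symbol is skew-symmetric under permutations; $\sum_{j=1}^{p+1}(-1)^j(H_{i_1},\dots,\widehat{H}_{i_j},\dots,H_{i_{p+1}})=0$ if $H_{i_1},\dots,H_{i_{p+1}}$ are not in general position and have nonempty intersection. Multiplication is concatenation. With $\omega(a)=\sum_{H}a(H)H\in\mathcal A^1(\mathcal C)$, set $d^{(a)}_{\mathcal A}:\mathcal A^p(\mathcal C)\to\mathcal A^{p+1}(\mathcal C)$, $x\mapsto\omega(a)\cdot x$. The algebra is identified with the algebra of differential forms generated by $\omega_j=df_j/f_j$ via $H_j\mapsto\omega_j$, where $f_j=0$ is a fixed degree-one defining equation of $H_j$. Flag space: a flag starting at a stratum $X$ with $l(X)=p$ is a sequence of strata $X_0\supset X_1\supset\dots\supset X_p=X$ with $l(X_i)=i$.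 $\mathcal F^p(\mathcal C)$ is the vector space spanned by symbols $F_{X_0,\dots,X_p}$ of all flags of length $p$, modulo the relations $\sum_{X:\,X_{j-1}\supset X\supset X_{j+1}}F_{X_0,\dots,X_{j-1},X,X_{j+1},\dots,X_p}=0$ for each $1\le j\le p-1$ and each incomplete flag missing its $j$-th term. Duality: for $H_{i_1},\dots,H_{i_p}$ in general position let $F(H_{i_1},\dots,H_{i_p})$ be the element of the flag $\mathbb C^k\supset H_{i_1}\supset H_{i_1}\cap H_{i_2}\supset\dots\supset H_{i_1}\cap\dots\cap H_{i_p}$. The (perfect) pairing $\mathcal A^p(\mathcal C)\otimes\mathcal F^p(\mathcal C)\to\mathbb C$ is: $\langle(H_{i_1},\dots,H_{i_p}),F\rangle=(-1)^{|\sigma|}$ if $F=F(H_{i_{\sigma(1)}},\dots,H_{i_{\sigma(p)}})$ for some $\sigma\in S_p$, and $0$ for any other flag $F$. The map $\delta_{\mathcal F}^{(a)}:\mathcal F^p(\mathcal C)\to\mathcal F^{p-1}(\mathcal C)$ is adjoint to $d^{(a)}_{\mathcal A}$. A vector $x\in\mathcal F^k(\mathcal C)$ is singular if $\delta^{(a)}_{\mathcal F}x=0$. Shapovalov form: the symmetric bilinear form on $\mathcal F^p(\mathcal C)$, $$S^{(a)}(F_1,F_2)=\sum_{\{i_1,\dots,i_p\}\subset J(\mathcal C)}a(H_{i_1})\cdots a(H_{i_p})\,\langle(H_{i_1},\dots,H_{i_p}),F_1\rangle\,\langle(H_{i_1},\dots,H_{i_p}),F_2\rangle,$$ the sum being over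 unordered $p$-element subsets. Master function: $\Phi=\prod_j f_j^{a(H_j)}$, a multivalued function on $U$. A point $t\in U$ is critical if $d\Phi|_t=0$, equivalently $\sum_j\frac{\partial f_j}{\partial t_i}\frac{a(H_j)}{f_j}=0$ at $t$ for $i=1,\dots,k$, where $t_1,\dots,t_k$ are fixed affine coordinates on $\mathbb C^k$. $\mathrm{Hess}^{(a)}(t)=\det_{1\le i,j\le k}\big(\frac{\partial^2}{\partial t_i\partial t_j}\ln\Phi\big)(t)$. Special vectors: every $\eta\in\mathcal A^k(\mathcal C)$ is $\eta=u\,dt_1\wedge\dots\wedge dt_k$ with $u$ rational and regular on $U$. For $t\in U$ the special vector $v(t)\in\mathcal F^k(\mathcal C)$ is the element with $\langle\eta,v(t)\rangle=u(t)$ for all $\eta\in\mathcal A^k(\mathcal C)$. *)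

(* Defs.v *)
From HB Require Import structures.
From mathcomp Require Import all_boot all_order all_algebra finmap perm.
From mathcomp Require Import complex.
From mathcomp Require Import boolp classical_sets functions reals topology.
From mathcomp Require Import normedtype derive.
Import Order.TTheory GRing.Theory Num.Theory numFieldNormedType.Exports.

Set Implicit Arguments.
Unset Strict Implicit.
Unset Printing Implicit Defensive.

Local Open Scope quotient_scope.
Local Open Scope ring_scope.
Local Open Scope classical_set_scope.

Section QuotientSpace.
Variables (K : fieldType) (V : vectType K) (U : {vspace V}).

Definition quotv_rel (x y : V) : bool := x - y \in U.

Lemma quotv_rel_refl : reflexive quotv_rel.
Proof. by move=> x; rewrite /quotv_rel subrr mem0v. Qed.

Lemma quotv_rel_sym : symmetric quotv_rel.
Proof. by move=> x y; rewrite /quotv_rel -opprB memvN. Qed.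

Lemma quotv_rel_trans : transitive quotv_rel.
Proof.
move=> y x z xy yz; rewrite /quotv_rel.
by rewrite -(subrK y x) -addrA; exact: memvD.
Qed.

Canonical quotv_equiv :=
  EquivRel quotv_rel quotv_rel_refl quotv_rel_sym quotv_rel_trans.

Definition quotv : Type := {eq_quot quotv_equiv}.

HB.instance Definition _ := EqQuotient.on quotv.
HB.instance Definition _ := Choice.on quotv.

Lemma quotv_piP (x y : V) : reflect (\pi_quotv x = \pi_quotv y) (x - y \in U).
Proof. by apply: (iffP idP) => [xy|/eqmodP//]; apply/eqmodP. Qed.

Definition quotv_zero : quotv := \pi_quotv 0.
Definition quotv_opp (x : quotv) : quotv := \pi_quotv (- repr x).
Definition quotv_add (x y : quotv) : quotv := \pi_quotv (repr x + repr y).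
Definition quotv_scale (c : K) (x : quotv) : quotv := \pi_quotv (c *: repr x).

Lemma repr_pi_mem (x : V) : repr (\pi_quotv x) - x \in U.
Proof. by apply/quotv_piP; rewrite reprK. Qed.

Lemma pi_quotv_add (x y : V) :
  quotv_add (\pi_quotv x) (\pi_quotv y) = \pi_quotv (x + y).
Proof.
apply/quotv_piP.
by rewrite opprD addrACA; apply: memvD; exact: repr_pi_mem.
Qed.

Lemma pi_quotv_opp (x : V) : quotv_opp (\pi_quotv x) = \pi_quotv (- x).
Proof. by apply/quotv_piP; rewrite -opprD memvN; exact: repr_pi_mem. Qed.

Lemma pi_quotv_scale (c : K) (x : V) :
  quotv_scale c (\pi_quotv x) = \pi_quotv (c *: x).
Proof. by apply/quotv_piP; rewrite -scalerBr memvZ // repr_pi_mem. Qed.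

Lemma quotv_addA : associative quotv_add.
Proof.
move=> x y z; elim/quotW: x => x; elim/quotW: y => y; elim/quotW: z => z.
by rewrite (pi_quotv_add y z) (pi_quotv_add x y) !pi_quotv_add addrA.
Qed.

Lemma quotv_addC : commutative quotv_add.
Proof. by move=> x y; rewrite /quotv_add addrC. Qed.

Lemma quotv_add0 : left_id quotv_zero quotv_add.
Proof. by move=> x; elim/quotW: x => x; rewrite pi_quotv_add add0r. Qed.

Lemma quotv_addN : left_inverse quotv_zero quotv_opp quotv_add.
Proof. by move=> x; elim/quotW: x => x; rewrite (pi_quotv_opp x) pi_quotv_add addNr. Qed.

HB.instance Definition _ := GRing.isZmodule.Build quotv
  quotv_addA quotv_addC quotv_add0 quotv_addN.

Lemma quotv_scaleA (a b : K) (x : quotv) :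
  quotv_scale a (quotv_scale b x) = quotv_scale (a * b) x.
Proof. by elim/quotW: x => x; rewrite (pi_quotv_scale b x) !pi_quotv_scale scalerA. Qed.

Lemma quotv_scale1 : left_id 1 quotv_scale.
Proof. by move=> x; elim/quotW: x => x; rewrite pi_quotv_scale scale1r. Qed.

Lemma quotv_scaleDr : right_distributive quotv_scale +%R.
Proof.
move=> a x y; elim/quotW: x => x; elim/quotW: y => y.
rewrite -[X in quotv_scale a X]/(quotv_add (\pi_quotv x) (\pi_quotv y)).
rewrite -[RHS]/(quotv_add _ _) (pi_quotv_add x y) (pi_quotv_scale a (x + y)).
by rewrite (pi_quotv_scale a x) (pi_quotv_scale a y) pi_quotv_add scalerDr.
Qed.

Lemma quotv_scaleDl (x : quotv) : {morph quotv_scale^~ x : a b / a + b}.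
Proof.
move=> a b; elim/quotW: x => x.
rewrite -[RHS]/(quotv_add _ _) (pi_quotv_scale (a + b) x).
by rewrite (pi_quotv_scale a x) (pi_quotv_scale b x) pi_quotv_add scalerDl.
Qed.

HB.instance Definition _ := GRing.Zmodule_isLmodule.Build K quotv
  quotv_scaleA quotv_scale1 quotv_scaleDr quotv_scaleDl.

End QuotientSpace.

(* The field of complex numbers, packed so that the topology and norm that
   MathComp-Analysis puts on a numClosedFieldType apply to it. *)
Definition CC (R : realType) : numClosedFieldType := R[i].

Definition affine_form (R : realType) (k : nat) (n : 'rV[CC R]_k) (b : CC R)
    (t : 'rV[CC R]_k) : CC R :=
  \sum_(i < k) n 0 i * t 0 i + b.

(* The defining equations f_j are part of the data. Distinct indices give
   distinct hyperplanes, so that exponents are functions on the index type. *)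
Record arrangement (R : realType) (k : nat) := Arrangement {
  plane_index : finType;
  normal : plane_index -> 'rV[CC R]_k;
  shift : plane_index -> CC R;
  normal_neq0 : forall j, normal j != 0;
  planes_distinct :
    injective (fun j => [set t | affine_form (normal j) (shift j) t = 0])
}.

Section Arrangement.
Variables (R : realType) (k : nat) (A : arrangement R k).
Local Notation C := (CC R).
Local Notation point := 'rV[C]_k.
Local Notation J := (plane_index A).

Definition defeq (j : J) : point -> C := affine_form (normal j) (shift j).

Definition hyperplane (j : J) : set point := [set t | defeq j t = 0].

Definition complement : set point := ~` \bigcup_(j in [set: J]) hyperplane j.

Definition inter (I : {set J}) : set point :=
  \bigcap_(j in [set` I]) hyperplane j.

Definition stratum : {fset set point} :=
  [fset inter I | I in [set I : {set J} | `[< inter I !=set0 >]]%SET]%fset.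

(* X is a (nonempty) affine subspace of codimension p. *)
Definition has_codim (X : set point) (p : nat) : Prop :=
  exists (x0 : point) (D : {vspace point}),
    X = [set x0 + u | u in [set` D]] /\ (\dim D + p)%N = k.

Definition has_vertex : Prop := exists X : stratum, has_codim (fsval X) k.

Definition general_position (p : nat) (h : p.-tuple J) : bool :=
  `[< has_codim (inter [set j in h]%SET) p >].

Definition permt (p : nat) (s : 'S_p) (h : p.-tuple J) : p.-tuple J :=
  [tuple tnth h (s j) | j < p].

Definition omitt (p : nat) (j : 'I_p.+1) (h : p.+1.-tuple J) : p.-tuple J :=
  [tuple tnth h (lift j i) | i < p].

Definition symbol (T : finType) (x : T) : {ffun T -> C^o} :=
  [ffun y => (y == x)%:R].

Definition OSrel (p : nat) : {vspace {ffun p.-tuple J -> C^o}} :=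
  (\sum_(h : p.-tuple J | ~~ general_position h) <[symbol h]>
   + \sum_(h : p.-tuple J) \sum_(s : 'S_p)
       <[symbol (permt s h) - (-1) ^+ s *: symbol h]>
   + \sum_(h : p.+1.-tuple J | ~~ general_position h
                               && `[< inter [set j in h]%SET !=set0 >])
       <[\sum_(j < p.+1) (-1) ^+ j.+1 *: symbol (omitt j h)]>)%VS.

(* The relations vanish for p = 0, so that OS 0 is the line spanned by the
   empty tuple. *)
Definition OS (p : nat) := quotv (OSrel p).

Definition OSsym (p : nat) (h : p.-tuple J) : OS p := \pi_(OS p) (symbol h).

(* This map, and the other multilinear maps below, are given on formal
   combinations and evaluated on representatives of the classes; they are
   compatible with the relations. *)
Definition OSmul (p q : nat) (x : OS p) (y : OS q) : OS (p + q) :=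
  \sum_(h : p.-tuple J) \sum_(g : q.-tuple J)
    (repr x h * repr y g) *: OSsym [tuple of h ++ g].

Definition is_flag (p : nat) (F : {ffun 'I_p.+1 -> stratum}) : bool :=
  [forall i, `[< has_codim (fsval (F i)) i >]]
  && [forall i : 'I_p.+1, forall j : 'I_p.+1,
        (i <= j)%N ==> `[< fsval (F j) `<=` fsval (F i) >]].

Definition flag (p : nat) := {F : {ffun 'I_p.+1 -> stratum} | is_flag F}.

(* An incomplete flag is given by a flag F and the position j of the missing
   term; incomplete flags without completion contribute the relation 0 = 0. *)
Definition Frel (p : nat) : {vspace {ffun flag p -> C^o}} :=
  (\sum_(F : flag p) \sum_(j : 'I_p.+1 | (0 < j < p)%N)
     <[\sum_(G : flag p | [forall i, (i != j) ==> (val G i == val F i)])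
         symbol G]>)%VS.

Definition FS (p : nat) := quotv (Frel p).

(* F is the flag C^k > H_1 > H_1 /\ H_2 > ... of h = (H_1, ..., H_p). *)
Definition flag_of_tuple (p : nat) (h : p.-tuple J) (F : flag p) : bool :=
  [forall m : 'I_p.+1, fsval (val F m) == inter [set j in take m h]%SET].

Definition pairing_sym (p : nat) (h : p.-tuple J) (F : flag p) : C :=
  if general_position h then
    if [pick s : 'S_p | flag_of_tuple (permt s h) F] is Some s
    then (-1) ^+ s else 0
  else 0.

Definition pairing (p : nat) (x : OS p) (y : FS p) : C :=
  \sum_(h : p.-tuple J) \sum_(F : flag p)
    repr x h * repr y F * pairing_sym h F.

Section Exponents.
Variable a : J -> C.

Definition omega : OS 1 := \sum_(j : J) a j *: OSsym [tuple j].

Definition dOS (p : nat) (x : OS p) : OS p.+1 := OSmul omega x.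

(* The adjoint of dOS: its value at x is the element representing the functional
   pairing (dOS -) x, which exists and is unique since pairing is perfect. *)
Definition deltaF (p : nat) (x : FS p.+1) : FS p :=
  xget 0 [set y : FS p | forall eta : OS p, pairing eta y = pairing (dOS eta) x].

(* deltaF vanishes on FS 0, its target being FS (-1) = 0. *)
Definition singular (p : nat) : FS p -> Prop :=
  match p with
  | 0 => fun=> True
  | q.+1 => fun x : FS q.+1 => deltaF x = 0
  end.

(* Each p-element subset of J contributes one tuple, its enumeration; the
   summand does not depend on the chosen ordering. *)
Definition shapovalov (p : nat) (x y : FS p) : C :=
  \sum_(h : p.-tuple J | val h == enum [set j in h]%SET)
    (\prod_(j <- h) a j) * pairing (OSsym h) x * pairing (OSsym h) y.

Definition unitv (i : 'I_k) : point := delta_mx 0 i.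

(* The partial derivative d (ln Phi) / d t_i, which is single-valued. *)
Definition dlnPhi (i : 'I_k) (t : point) : C :=
  \sum_(j : J) 'D_(unitv i) (defeq j) t * (a j / defeq j t).

Definition critical : set point :=
  [set t | complement t /\ forall i, dlnPhi i t = 0].

Definition hessian (t : point) : C :=
  \det (\matrix_(i < k, j < k) 'D_(unitv i) (dlnPhi j) t).

End Exponents.

(* Differential p-forms are evaluated at the p rows of a matrix W. *)
Definition wedge (p : nat) (phi : 'I_p -> point -> C) (W : 'M[C]_(p, k)) : C :=
  \det (\matrix_(i < p, j < p) phi i (row j W)).

Definition dlog (j : J) (t : point) : point -> C :=
  fun w => 'D_w (defeq j) t / defeq j t.

(* The differential form of x, through H_j |-> df_j / f_j, at the point t. *)
Definition OSform (p : nat) (x : OS p) (t : point) (W : 'M[C]_(p, k)) : C :=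
  \sum_(h : p.-tuple J) repr x h * wedge (fun i => dlog (tnth h i) t) W.

Definition dvol (W : 'M[C]_(k, k)) : C :=
  wedge (fun (i : 'I_k) (w : point) => w 0 i) W.

(* If x is the form u dt_1 /\ ... /\ dt_k then <x, special t> = u t. *)
Definition special (t : point) : FS k :=
  xget 0 [set y : FS k | forall (x : OS k) (W : 'M[C]_(k, k)),
    OSform x t W = pairing x y * dvol W].

End Arrangement.

(* Main.v *)
Require Import Defs.
From mathcomp Require Import all_boot all_order all_algebra.
From mathcomp Require Import perm finmap zify ring.
From mathcomp Require Import boolp classical_sets functions reals topology.
From mathcomp Require Import normedtype derive.
Import GRing.Theory Num.Theory numFieldNormedType.Exports.
Local Open Scope quotient_scope.
Local Open Scope ring_scope.
Local Open Scope classical_set_scope.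

(** Write n_j for the linear part of f_j. The proof rests on the formula
      <(H_1, ..., H_k), v(t)> = det (n_1 / f_1(t), ..., n_k / f_k(t)),
    the coefficient of the form omega_1 ... omega_k at t ([pairing_special]).

    By the Cauchy-Binet formula it gives S(v(t1), v(t2)) = det G(t1, t2), where
      G(t1, t2) = sum_j a_j n_j^T n_j / (f_j(t1) f_j(t2))
    ([shapovalov_special]). Differentiating ln Phi twice, one finds that
    G(t, t) is minus the Hessian matrix, whence (ii). Since
    (t2 - t1) n_j^T = f_j(t2) - f_j(t1), the row vector (t2 - t1) G(t1, t2) is
    the difference of the gradients of ln Phi at t1 and at t2
    ([gram_critical]); at two distinct critical points it vanishes, so G(t1, t2)
    is singular, whence (iii).

    For (i), <omega(a) x, v(t)> is the coefficient at t of the form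
    omega(a) /\ x ([special_dOS]). As the pairing is perfect, v(t) is singular
    if and only if omega(a) at t has zero product with all (k-1)-forms of the
    algebra. A vertex provides k hyperplanes with independent normals, so these
    forms span all (k-1)-forms at t, and the condition becomes omega(a) = 0 at
    t, which says that t is critical ([deltaF_special]).

    What remains is that the pairing is perfect: surjectivity of F onto the
    dual of A gives the existence of v(t) and of the adjoint
    ([OS_functional_represented]), and injectivity makes the adjoint unique
    ([pairing_FS_inj]). Choose, for every stratum X of positive codimension, a
    hyperplane c(X) containing it, and call (H_1, ..., H_p) adapted if
    H_i = c(H_1 /\ ... /\ H_i) for all i. When c(X) is the smallest hyperplane
    through X for some order, these are the monomials without broken circuits,
    but any choice will do. A function on tuples which obeys the relations of A
    and vanishes on adapted tuples is zero ([OS_compatible_eq0]); the relations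
    of F reduce every flag to flags of adapted tuples ([symbol_adapted_span]);
    and the pairing of adapted tuples with their flags is the identity matrix
    ([pairing_adapted]). Hence adapted tuples and their flags are dual bases.

    The compatibility of the pairing with both families of relations is seen on
    a determinant: <(H_1, ..., H_p), F> = det (e_im), where e_im is 1 if H_i
    contains the m-th term of F but not the preceding one, and 0 otherwise
    ([pairing_sym_det]). *)

Set Implicit Arguments.
Unset Strict Implicit.
Unset Printing Implicit Defensive.

(* Simplification would otherwise replace [CC R] by [R[i]], and the algebraic
   structures found for the two types are not syntactically equal. *)
Local Opaque CC.

(** * Intersections of hyperplanes and their codimension *)
Definition tuple_rows (T J : Type) (p n : nat) (w : J -> 'rV[T]_n)
  (h : p.-tuple J) : 'M[T]_(p, n) := \matrix_i w (tnth h i).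

Section Geometry.
Variables (R : realType) (k : nat) (A : arrangement R k).
Local Notation C := (CC R).
Local Notation point := 'rV[C]_k.
Local Notation J := (plane_index A).

(** Lists are better suited than sets of indices to prefixes of a tuple, whose
    intersections are the terms of its flag. *)
Definition zeros (s : seq J) : set point :=
  [set t | forall j, j \in s -> defeq j t = 0].

Lemma inter_zeros (s : seq J) : inter [set j in s]%SET = zeros s.
Proof.
apply/seteqP; split=> t ht j.
  by move=> js; apply: ht; rewrite /= inE.
by rewrite /= inE; apply: ht.
Qed.

Lemma interE (I : {set J}) : inter I = zeros (enum I).
Proof.
by rewrite -inter_zeros; congr (inter _); apply/setP => j; rewrite inE mem_enum.
Qed.

Lemma zeros_cat s r : zeros (s ++ r) = zeros s `&` zeros r.
Proof.
apply/seteqP; split=> [t ht|t [hs hr] j]; last by rewrite mem_cat => /orP[/hs|/hr].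
by split=> j hj; apply: ht; rewrite mem_cat hj ?orbT.
Qed.

Lemma zeros1 j : zeros [:: j] = hyperplane j.
Proof.
apply/seteqP; split=> [t ht|t ht i]; first by apply: ht; rewrite inE.
by rewrite inE => /eqP->.
Qed.

Lemma zeros0 : zeros [::] = [set: point].
Proof. by apply/seteqP; split=> // t _ j; rewrite in_nil. Qed.

Lemma zeros_cons j s : zeros (j :: s) = hyperplane j `&` zeros s.
Proof. by rewrite -cat1s zeros_cat zeros1. Qed.

Lemma zerosS s r : {subset s <= r} -> zeros r `<=` zeros s.
Proof. by move=> sr t ht j /sr /ht. Qed.

Lemma zeros_hyperplane s j : j \in s -> zeros s `<=` hyperplane j.
Proof. by move=> js t; apply. Qed.

Lemma defeqD (j : J) (x u : point) :
  defeq j (x + u) = defeq j x + (u *m (normal j)^T) 0 0.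
Proof.
rewrite /defeq /affine_form addrAC !mxE -big_split /=; congr (_ + _)%R.
by apply: eq_bigr => i _; rewrite !mxE mulrDr [u _ _ * _]mulrC.
Qed.

Lemma codim_base (X : set point) p x : has_codim X p -> X x ->
  exists D : {vspace point},
    (forall u, X (x + u) <-> u \in D) /\ (\dim D + p = k)%N.
Proof.
move=> [x0 [D [-> dD]]] [d /= dD0 <-]; exists D; split=> // u; split.
  move=> [w /= wD]; rewrite -addrA => /addrI wE.
  by rewrite -(addKr d u) -wE addrC; apply: memvB.
by move=> uD; exists (d + u); rewrite ?addrA //=; apply: memvD.
Qed.

Lemma codim_neq0 (X : set point) p : has_codim X p -> X !=set0.
Proof. by move=> [x0 [D [-> _]]]; exists (x0 + 0); exists 0 => //=; apply: mem0v. Qed.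

Lemma codim_le (X Y : set point) p q :
  has_codim X p -> has_codim Y q -> X `<=` Y -> (q <= p)%N.
Proof.
move=> cX cY XY; have [x Xx] := codim_neq0 cX.
have [D [hD dD]] := codim_base cX Xx; have [E [hE dE]] := codim_base cY (XY _ Xx).
have : (D <= E)%VS by apply/subvP => u /hD /XY /hE.
by move/dimvS; lia.
Qed.

Lemma codim_eq (X Y : set point) p :
  has_codim X p -> has_codim Y p -> X `<=` Y -> X = Y.
Proof.
move=> cX cY XY; have [x Xx] := codim_neq0 cX.
have [D [hD dD]] := codim_base cX Xx; have [E [hE dE]] := codim_base cY (XY _ Xx).
have DE : D = E.
  apply/eqP; rewrite eqEdim; apply/andP; split.
    by apply/subvP => u /hD /XY /hE.
  by lia.
apply/seteqP; split=> // t Yt; rewrite -(subrK x t) addrC.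
by apply/hD; rewrite DE; apply/hE; rewrite addrC subrK.
Qed.

Lemma codim_uniq (X : set point) p q : has_codim X p -> has_codim X q -> p = q.
Proof.
by move=> cp cq; apply/eqP; rewrite eqn_leq (codim_le cq cp) // (codim_le cp cq).
Qed.

Lemma codim_setT : has_codim [set: point] 0.
Proof.
exists 0, fullv; split; last by rewrite dimvf addn0 /dim /= mul1n.
by apply/seteqP; split=> // t _; exists t; rewrite ?add0r //=; apply: memvf.
Qed.

(** The step by which flags are built. The point common to X and to the
    hyperplane serves as origin for both; the hyperplane is the kernel of a
    linear form which does not vanish on the direction of X. *)
Lemma codim_cut (X : set point) p (j : J) : has_codim X p ->
  ~ X `<=` hyperplane j -> X `&` hyperplane j !=set0 ->
  has_codim (X `&` hyperplane j) p.+1.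
Proof.
move=> cX nXj [x [Xx jx]]; have [D [hD dD]] := codim_base cX Xx.
pose f := linfun (mulmxr (normal j)^T) : 'Hom(point, 'M[C]_1).
have fE u : f u = u *m (normal j)^T by rewrite lfunE.
exists x, (D :&: lker f)%VS; split.
  apply/seteqP; split=> [t [Xt jt]|t [u /=]].
    exists (t - x); last by rewrite addrC subrK.
    rewrite /= memv_cap memv_ker; apply/andP; split.
      by apply/hD; rewrite addrC subrK.
    rewrite fE; apply/eqP/matrixP => a b; rewrite !ord1 [RHS]mxE.
    have := defeqD j x (t - x); rewrite (addrC x) subrK.
    by rewrite [defeq j t]jt [defeq j x]jx add0r => <-.
  rewrite memv_cap memv_ker fE => /andP[/hD Xu /eqP u0] <-; split=> //.
  by rewrite /hyperplane /= defeqD u0 mxE addr0.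
have [d [dDm fd]] : exists d, d \in D /\ f d != 0.
  apply: contra_notP nXj => /forallNP h t Xt.
  have tD : t - x \in D by apply/hD; rewrite addrC subrK.
  have /not_andP [//|/negP] := h (t - x); rewrite negbK fE => /eqP u0.
  have := defeqD j x (t - x); rewrite (addrC x) subrK u0 [defeq j x]jx mxE addr0.
  by [].
have df : \dim (f @: D) = 1%N.
  apply/eqP; rewrite eqn_leq; apply/andP; split.
    by rewrite (leq_trans (dimvS (subvf _))) // dimvf /dim /= mul1n.
  by rewrite lt0n dimv_eq0; apply/negP => /eqP fD0; move: fd;
     rewrite -memv0 -fD0 memv_img.
have := limg_ker_dim f D; rewrite df => dimE.
by rewrite addnS -addSn -[(\dim _).+1]addn1 dimE.
Qed.

(** Each hyperplane raises the codimension by at most one, so that a tuple in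
    general position has prefixes in general position. *)
Lemma codim_zeros_cap (X : set point) p s : has_codim X p ->
  X `&` zeros s !=set0 ->
  exists2 q, (q <= p + size s)%N & has_codim (X `&` zeros s) q.
Proof.
elim: s X p => [|j s IH] X p cX; first by rewrite zeros0 setIT; exists p; rewrite ?addn0.
rewrite zeros_cons setIA => ne.
have [Xj|Xj] := pselect (X `<=` hyperplane j).
  move: ne; rewrite (_ : X `&` hyperplane j = X); last exact/setIidPl.
  by move=> /(IH _ _ cX) [q qp cq]; exists q => //=; lia.
have ne' : X `&` hyperplane j !=set0 by case: ne => x [h _]; exists x.
by have [q qp cq] := IH _ _ (codim_cut cX Xj ne') ne; exists q => //=; lia.
Qed.

Lemma codim_zeros s : zeros s !=set0 -> exists2 q, (q <= size s)%N & has_codim (zeros s) q.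
Proof. by move=> ne; have := @codim_zeros_cap _ _ s codim_setT; rewrite setTI; apply. Qed.

Lemma codim_take (s : seq J) m : has_codim (zeros s) (size s) -> (m <= size s)%N ->
  has_codim (zeros (take m s)) m.
Proof.
move=> cs ms; have ne : zeros (take m s) !=set0.
  by have [x xs] := codim_neq0 cs; exists x => j /mem_take /xs.
have [q qm cq] := codim_zeros ne.
have ne2 : zeros (take m s) `&` zeros (drop m s) !=set0.
  by rewrite -zeros_cat cat_take_drop; apply: codim_neq0 cs.
have [r rq] := codim_zeros_cap cq ne2; rewrite -zeros_cat cat_take_drop => cr.
have rs := codim_uniq cr cs.
move: qm rq; rewrite rs size_drop size_takel // => qm rq.
have mq : m = q by lia.
by rewrite [X in has_codim _ X]mq.
Qed.

Lemma codim_cut_eq (X : set point) p (j : J) : has_codim X p -> ~ X `<=` hyperplane j ->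
  forall Y, has_codim Y p.+1 -> Y `<=` X -> Y `<=` hyperplane j -> Y = X `&` hyperplane j.
Proof.
move=> cX Xj Y cY YX Yj; have [y Yy] := codim_neq0 cY.
apply: (codim_eq cY); last by move=> t Yt; split; [apply: YX|apply: Yj].
by apply: codim_cut => //; exists y; split; [apply: YX|apply: Yj].
Qed.

Local Notation normals := (tuple_rows (@normal R k A)).

Lemma normalsE p (h : p.-tuple J) (x : point) i :
  (x *m (normals h)^T) 0 i = (x *m (normal (tnth h i))^T) 0 0.
Proof. by rewrite !mxE; apply: eq_bigr => j _; rewrite !mxE. Qed.

(** Independent normals already force the intersection to be nonempty: the
    affine system has full rank. Contrapositively, hyperplanes which are not in
    general position have dependent normals, whether or not they meet. *)
Lemma row_free_codim p (h : p.-tuple J) : row_free (normals h) ->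
  has_codim (zeros h) p.
Proof.
move=> fN; have [x xh] : exists x, zeros h x.
  have /row_fullP [B NB] : row_full (normals h)^T by rewrite /row_full mxrank_tr; apply: fN.
  exists (- (\row_i Defs.shift (tnth h i)) *m B) => j /tnthP [i ->].
  have := defeqD (tnth h i) 0 (- (\row_i Defs.shift (tnth h i)) *m B).
  rewrite add0r -normalsE -mulmxA NB mulmx1 => ->; rewrite !mxE /defeq /affine_form.
  by rewrite big1 ?add0r ?subrr // => l _; rewrite mxE mulr0.
pose f := linfun (mulmxr (normals h)^T) : 'Hom(point, 'rV[C]_p).
have fE u : f u = u *m (normals h)^T by rewrite lfunE.
exists x, (lker f); split.
  apply/seteqP; split=> [t ht|t [u /=]].
    exists (t - x); last by rewrite addrC subrK.
    rewrite /= memv_ker fE; apply/eqP/rowP => i; rewrite normalsE [RHS]mxE.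
    have := defeqD (tnth h i) x (t - x); rewrite (addrC x) subrK.
    by rewrite ht ?xh ?mem_tnth // add0r => <-.
  rewrite memv_ker fE => /eqP u0 <- j /tnthP [i ->].
  by rewrite defeqD -normalsE u0 mxE addr0 xh // mem_tnth.
have limgf : limg f = fullv.
  apply/eqP; rewrite eqEsubv subvf; apply/subvP => v _.
  have /row_fullP [B NB] : row_full (normals h)^T by rewrite /row_full mxrank_tr; apply: fN.
  by rewrite (_ : v = f (v *m B)) ?memv_img ?memvf // fE -mulmxA NB mulmx1.
have := limg_ker_dim f fullv; rewrite capfv limgf !dimvf /dim /= !mul1n. 
by [].
Qed.
End Geometry.

(** * The pairing as a determinant *)
Section Flags.
Variables (R : realType) (k : nat) (A : arrangement R k).
Local Notation C := (CC R).
Local Notation point := 'rV[C]_k.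
Local Notation J := (plane_index A).

Lemma stratumP (X : set point) :
  X \in stratum A <-> X !=set0 /\ exists s : seq J, X = zeros s.
Proof.
split=> [/imfsetP [I /=]|[ne [s sE]]]; last rewrite {}sE in ne *.
  by rewrite inE => /asboolP ne ->; split=> //; exists (enum I); rewrite interE.
apply/imfsetP; exists [set j in s]%SET => /=; last by rewrite inter_zeros.
by rewrite inE; apply/asboolP; rewrite inter_zeros.
Qed.

Section Length.
Variable p : nat.
Implicit Types (F G : flag A p) (h : p.-tuple J).

(** Indexing by natural numbers spares the casts between ordinals; only indices
    up to p are meaningful. *)
Definition term F (m : nat) : set point := fsval (val F (inord m)).

Lemma term_codim F m : (m <= p)%N -> has_codim (term F m) m.
Proof.
move=> mp; have /andP [/forallP /(_ (inord m)) /asboolP] := valP F.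
by rewrite inordK.
Qed.

Lemma term_sub F m n : (m <= n)%N -> (n <= p)%N -> term F n `<=` term F m.
Proof.
move=> mn np; have /andP [_ /forallP /(_ (inord m)) /forallP /(_ (inord n))] := valP F.
have mp := leq_trans mn np.
by rewrite !inordK ?ltnS // mn => /asboolP.
Qed.

Lemma term_stratum F m : term F m \in stratum A.
Proof. exact: valP. Qed.

Lemma term_zeros F m : exists s : seq J, term F m = zeros s.
Proof. by have /stratumP [] := term_stratum F m. Qed.

Lemma term_neq0 F m : term F m !=set0.
Proof. by have /stratumP [] := term_stratum F m. Qed.

Lemma flag_eq F G : (forall m, (m <= p)%N -> term F m = term G m) -> F = G.
Proof.
move=> FG; apply/val_inj/ffunP => i; apply/val_inj.
by have := FG i; rewrite /term inord_val -ltnS => /(_ (ltn_ord i)).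
Qed.

Lemma term_ord F (i : 'I_p.+1) : fsval (val F i) = term F i.
Proof. by rewrite /term inord_val. Qed.

Lemma flag_exists (X : nat -> set point) :
  (forall m, (m <= p)%N -> has_codim (X m) m) ->
  (forall m, (m <= p)%N -> exists s : seq J, X m = zeros s) ->
  (forall m, (m < p)%N -> X m.+1 `<=` X m) ->
  exists F, forall m, (m <= p)%N -> term F m = X m.
Proof.
move=> cX sX subX.
have mX (i : 'I_p.+1) : X i \in stratum A.
  by apply/stratumP; split; [apply: codim_neq0 (cX i _)|apply: sX]; rewrite -ltnS ltn_ord.
pose f : {ffun 'I_p.+1 -> stratum A} := [ffun i => FSetSub (mX i)].
have subX' n m : (n + m <= p)%N -> X (n + m)%N `<=` X n.
  elim: m => [|m IH]; first by rewrite addn0 => _ t.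
  rewrite addnS => nm.
  by apply: subset_trans (subX _ nm) (IH _); apply: ltnW.
have fP : is_flag f.
  apply/andP; split; first by apply/forallP => i; rewrite ffunE; apply/asboolP/cX; rewrite -ltnS.
  apply/forallP => i; apply/forallP => j; apply/implyP => ij; rewrite !ffunE.
  by apply/asboolP; have := @subX' i (j - i)%N; rewrite subnKC //; apply; rewrite -ltnS.
exists (exist _ f fP) => m mp.
by rewrite /term /= ffunE /= inordK.
Qed.

Lemma term0 F : term F 0 = [set: point].
Proof. by apply: (codim_eq (term_codim F _) (codim_setT R k)). Qed.

Lemma term_cut F m (j : J) : (m < p)%N -> ~ term F m `<=` hyperplane j ->
  term F m.+1 `<=` hyperplane j -> term F m.+1 = term F m `&` hyperplane j.
Proof.
move=> mp Fm; apply: codim_cut_eq Fm _ (term_codim F mp) _; first exact: term_codim (ltnW mp).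
exact: term_sub.
Qed.

Lemma term_nsub F m : (m < p)%N -> ~ term F m `<=` term F m.+1.
Proof.
move=> mp Fm; have := codim_le (term_codim F (ltnW mp)) (term_codim F mp) Fm.
by rewrite ltnn.
Qed.

Lemma flag_of_tupleP h F : reflect
  (forall m, (m <= p)%N -> term F m = zeros (take m h)) (flag_of_tuple h F).
Proof.
apply: (iffP forallP) => [hF m mp|hF m].
  by have /eqP := hF (inord m); rewrite inter_zeros inordK ?ltnS.
by rewrite inter_zeros term_ord hF // -ltnS.
Qed.

Lemma take_tnth h (i : 'I_p) : take i.+1 h = rcons (take i h) (tnth h i).
Proof. by rewrite (take_nth (tnth_default h i)) ?size_tuple // -tnth_nth. Qed.

Lemma zeros_rcons s (j : J) : zeros (rcons s j) = zeros s `&` hyperplane j.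
Proof. by rewrite -cats1 zeros_cat zeros1. Qed.

(** Each term of a flag is a hyperplane section of the preceding one, hence it is
    determined by any hyperplane which contains it but not the preceding term. *)
Lemma flag_of_tuple_cut h F : flag_of_tuple h F <->
  forall i : 'I_p, term F i.+1 `<=` hyperplane (tnth h i) /\
                   ~ term F i `<=` hyperplane (tnth h i).
Proof.
split=> [/flag_of_tupleP hF i|hF].
  have Fi : term F i.+1 = term F i `&` hyperplane (tnth h i).
    by rewrite !hF ?take_tnth ?zeros_rcons // ltnW.
  split; first by rewrite Fi => t [].
  move=> sub; apply: (@term_nsub F i) => //; rewrite Fi => t Ft; split=> //.
  exact: sub.
apply/flag_of_tupleP; elim=> [|m IH] mp; first by rewrite take0 zeros0 term0.
have [sub nsub] := hF (Ordinal mp).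
rewrite (term_cut mp nsub sub) IH; last exact: ltnW.
by rewrite -[m.+1]/((Ordinal mp).+1) take_tnth zeros_rcons.
Qed.

Lemma flag_of_tuple_codim h F : flag_of_tuple h F -> has_codim (zeros h) p.
Proof.
move=> /flag_of_tupleP /(_ p (leqnn p)).
by rewrite take_oversize ?size_tuple // => <-; apply: term_codim.
Qed.

Lemma general_positionE h : general_position h = `[<has_codim (zeros h) p>].
Proof. by rewrite /general_position inter_zeros. Qed.

Lemma flag_of_tuple_exists h : has_codim (zeros h) p -> exists F, flag_of_tuple h F.
Proof.
move=> hp; have [|||F FE] := @flag_exists (fun m => zeros (take m h)).
- by move=> m mp; apply: codim_take; rewrite size_tuple.
- by move=> m _; exists (take m h).
- move=> m mp; rewrite -[m.+1]/((Ordinal mp).+1) take_tnth zeros_rcons.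
  by move=> t [].
by exists F; apply/flag_of_tupleP.
Qed.

Lemma zeros_permt h (s : 'S_p) : zeros (permt s h) = zeros h.
Proof.
apply/seteqP; split; apply: zerosS => j /tnthP [i ->].
  by apply/tnthP; exists (s^-1 i)%g; rewrite tnth_mktuple permKV.
by rewrite tnth_mktuple mem_tnth.
Qed.

Definition lies_in (X : set point) (j : J) : bool := `[< X `<=` hyperplane j >].

(** As a difference of indicators, the entry is linear in each term of the flag;
    this is what makes the relation among flags visible on the determinant. *)
Definition entry F (j : J) (m : nat) : C :=
  (lies_in (term F m.+1) j)%:R - (lies_in (term F m) j)%:R.

Definition entry_mx h F : 'M[C]_p := \matrix_(i, m) entry F (tnth h i) m.

Lemma entryE F j m : (m < p)%N -> entry F j m =
  (lies_in (term F m.+1) j && ~~ lies_in (term F m) j)%:R.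
Proof.
move=> mp; rewrite /entry; case: (boolP (lies_in (term F m) j)) => [/asboolP Fm|_].
  rewrite andbF (_ : lies_in _ _ = true) ?subrr //.
  by apply/asboolP; apply: (subset_trans _ Fm); apply: term_sub.
by rewrite andbT subr0.
Qed.

Lemma entry_uniq F j m n : (m < p)%N -> (n < p)%N ->
  term F m.+1 `<=` hyperplane j -> ~ term F m `<=` hyperplane j ->
  entry F j n = (m == n)%:R.
Proof.
move=> mp np sub nsub; rewrite entryE //; apply: (congr1 (fun b : bool => b%:R)).
have [mn|nm|<-] := ltngtP m n.
- apply/negbTE; rewrite negb_and negbK; apply/orP; right; apply/asboolP.
  by apply: (subset_trans _ sub); apply: term_sub => //; apply: ltnW.
- apply/negbTE; rewrite negb_and; apply/orP; left; apply/asboolPn => H.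
  by apply: nsub; apply: (subset_trans _ H); apply: term_sub => //; apply: ltnW.
- by apply/andP; split; [apply/asboolP|apply/asboolPn].
Qed.

Lemma tnth_permt h (s : 'S_p) i : tnth (permt s h) i = tnth h (s i).
Proof. by rewrite tnth_mktuple. Qed.

Lemma entry_mx_permt h (s : 'S_p) F : flag_of_tuple (permt s h) F ->
  entry_mx h F = perm_mx s^-1.
Proof.
move=> /flag_of_tuple_cut hF; apply/matrixP => i m; rewrite !mxE.
have [] := hF (s^-1 i)%g; rewrite tnth_permt permKV => sub nsub.
by rewrite (entry_uniq (m := (s^-1 i)%g) _ _ sub nsub).
Qed.

Lemma det_entry_neq0 h F : \det (entry_mx h F) != 0 ->
  exists s : 'S_p, flag_of_tuple (permt s h) F.
Proof.
move=> d0; have [s Ps] : exists s : 'S_p, \prod_i entry_mx h F i (s i) != 0.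
  apply: contraPP d0 => /forallNP P; apply/negP; rewrite negbK; apply/eqP.
  rewrite /determinant big1 // => s _.
  by have /negP := P s; rewrite negbK => /eqP ->; rewrite mulr0.
exists (s^-1)%g; apply/flag_of_tuple_cut => i; rewrite tnth_permt.
have : entry_mx h F (s^-1 i)%g i != 0.
  apply: contraNneq Ps => e0; apply/eqP; rewrite (bigD1 (s^-1 i)%g) //= permKV e0.
  by rewrite mul0r.
rewrite mxE entryE // pnatr_eq0 eqb0 negbK => /andP [/asboolP ? /asboolPn ?].
by split.
Qed.

(** Every row of the matrix has at most one nonzero entry, which is 1, so a
    nonzero term in the expansion is a bijection from the hyperplanes to the
    steps of F; such a bijection is an ordering of h whose flag is F, and the
    matrix is then the corresponding permutation matrix. *)
Lemma pairing_sym_det h F : pairing_sym h F = \det (entry_mx h F).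
Proof.
rewrite /pairing_sym; case: pickP => [s sF|no].
  rewrite general_positionE asboolT.
    by rewrite (entry_mx_permt sF) det_perm odd_permV.
  by rewrite -(zeros_permt h s); apply: flag_of_tuple_codim sF.
rewrite if_same; apply/esym/eqP; apply: contraT => /det_entry_neq0 [s].
by rewrite no.
Qed.

End Length.
End Flags.

(** * Linear functionals and determinants *)
Section Linear.
Variable (C : fieldType).
Definition lin_ext (T : finType) (phi : T -> C) (x : {ffun T -> C^o}) : C :=
  \sum_(h : T) x h * phi h.

Lemma lin_extD (T : finType) (phi : T -> C) x y :
  lin_ext phi (x + y) = lin_ext phi x + lin_ext phi y.
Proof.
by rewrite /lin_ext -big_split /=; apply: eq_bigr => h _; rewrite ffunE mulrDl.
Qed.

Lemma lin_extZ (T : finType) (phi : T -> C) a x : lin_ext phi (a *: x) = a * lin_ext phi x.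
Proof.
by rewrite /lin_ext big_distrr /=; apply: eq_bigr => h _; rewrite ffunE -mulrA.
Qed.

Lemma lin_extN (T : finType) (phi : T -> C) x : lin_ext phi (- x) = - lin_ext phi x.
Proof. by rewrite -scaleN1r lin_extZ mulN1r. Qed.

Lemma lin_ext0 (T : finType) (phi : T -> C) : lin_ext phi 0 = 0.
Proof. by rewrite -(scale0r 0) lin_extZ mul0r. Qed.

Lemma lin_ext_sum (T : finType) (phi : T -> C) I (r : seq I) (P : pred I) X :
  lin_ext phi (\sum_(i <- r | P i) X i) = \sum_(i <- r | P i) lin_ext phi (X i).
Proof.
by elim/big_rec2: _ => [|i y x _ <-]; rewrite ?lin_ext0 // lin_extD.
Qed.

Lemma eq_lin_ext (T : finType) (phi psi : T -> C) x : phi =1 psi -> lin_ext phi x = lin_ext psi x.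
Proof. by move=> e; apply: eq_bigr => h _; rewrite e. Qed.

Lemma lin_ext_line (T : finType) (phi : T -> C) g x :
  lin_ext phi g = 0 -> x \in <[g]>%VS -> lin_ext phi x = 0.
Proof. by move=> g0 /vlineP [a ->]; rewrite lin_extZ g0 mulr0. Qed.

Lemma lin_ext_sumv (T I : finType) (P : pred I) (U : I -> {vspace {ffun T -> C^o}})
    (phi : T -> C) x :
  (forall i, P i -> forall y, y \in U i -> lin_ext phi y = 0) ->
  x \in (\sum_(i | P i) U i)%VS -> lin_ext phi x = 0.
Proof.
move=> h /memv_sumP [y yU ->]; rewrite lin_ext_sum big1 // => i Pi.
exact: h (yU i Pi).
Qed.

Lemma ffun_delta (T : finType) (x : {ffun T -> C^o}) :
  x = \sum_t x t *: [ffun u => (u == t)%:R : C^o].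
Proof.
apply/ffunP => u; rewrite sum_ffunE (bigD1 u) //= big1 => [|t tu].
  by rewrite addr0 !ffunE eqxx; apply/esym/mulr1.
by rewrite !ffunE eq_sym (negbTE tu); apply: mulr0.
Qed.

Lemma det_add_row n (M : 'M[C]_n) (a b : 'I_n) : a != b ->
  \det (\matrix_(i, m) (if i == b then M a m + M b m else M i m)) = \det M.
Proof.
move=> ab; set M' := (X in \det X = _).
pose Ma := \matrix_(i, m) (if i == b then M a m else M i m).
rewrite (@determinant_multilinear _ _ M' Ma M b 1 1).
- rewrite (@determinant_alternate _ _ Ma a b) ?mulr0 ?mul1r ?add0r // => m.
  by rewrite !mxE (negbTE ab) eqxx.
- by apply/rowP => m; rewrite !mxE eqxx !mul1r.
- by apply/matrixP => i m; rewrite !mxE (eq_sym _ b) (negbTE (neq_lift _ _)).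
- by apply/matrixP => i m; rewrite !mxE (eq_sym _ b) (negbTE (neq_lift _ _)).
Qed.

(** The expansion of the determinant of M bordered by a column of ones. The
    relation of the Orlik-Solomon algebra is of this shape, both for the pairing
    and for differential forms. *)
Lemma alternating_minors n (M : 'M[C]_(n.+1, n)) :
  \sum_(j < n.+1) (-1) ^+ j.+1 * \det (row' j M) = (-1) ^+ n.+1 *
  \det (\matrix_(i, m < n.+1) (if unlift ord_max m is Some l then M i l else 1)).
Proof.
rewrite (expand_det_col _ ord_max) big_distrr /=; apply: eq_bigr => i _.
rewrite mxE unlift_none mul1r /cofactor mulrA -exprD; congr (_ * _); last first.
  by congr (\det _); apply/matrixP => a b; rewrite !mxE liftK.
rewrite (_ : (n.+1 + (i + @ord_max n))%N = (i.+1 + 2 * n)%N); last by rewrite /=; lia.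
by rewrite exprD exprM sqrrN !expr1n mulr1.
Qed.

Lemma alternating_minors_row n (M : 'M[C]_(n.+1, n)) (v : 'rV_n.+1) :
  v != 0 -> v *m M = 0 -> \sum_i v 0 i = 0 ->
  \sum_(j < n.+1) (-1) ^+ j.+1 * \det (row' j M) = 0.
Proof.
move=> v0 vM vs; rewrite alternating_minors.
set E := (X in \det X); have /det0P/eqP -> : exists2 w : 'rV_n.+1, w != 0 & w *m E = 0.
  exists v => //; apply/rowP => m; rewrite !mxE.
  have [l|] := unliftP ord_max m => mE.
    rewrite -[RHS](_ : (v *m M) 0 l = 0); last by rewrite vM mxE.
    by rewrite mxE; apply: eq_bigr => i _; rewrite mxE mE liftK.
  by rewrite -[RHS]vs; apply: eq_bigr => i _; rewrite mxE mE unlift_none mulr1.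
by rewrite mulr0.
Qed.

Lemma alternating_minors_col n (M : 'M[C]_(n.+1, n)) (w : 'cV_n) :
  M *m w = const_mx 1 -> \sum_(j < n.+1) (-1) ^+ j.+1 * \det (row' j M) = 0.
Proof.
move=> Mw; rewrite alternating_minors -det_tr.
set E := (X in \det X); have /det0P/eqP -> : exists2 u : 'rV_n.+1, u != 0 & u *m E = 0.
  exists (\row_m (if unlift ord_max m is Some l then w l 0 else -1)).
    apply/negP => /eqP /rowP /(_ ord_max); rewrite !mxE unlift_none => /eqP.
    by rewrite oppr_eq0 oner_eq0.
  apply/rowP => i; rewrite !mxE big_ord_recr /= !mxE unlift_none mulN1r.
  apply/eqP; rewrite subr_eq0; apply/eqP.
  have /matrixP /(_ i 0) := Mw; rewrite !mxE => <-; apply: eq_bigr => l _.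
  have -> : widen_ord (leqnSn n) l = lift ord_max l by apply: val_inj; rewrite [RHS]lift_max.
  by rewrite !mxE liftK mulrC.
by rewrite mulr0.
Qed.
End Linear.

(** * Compatibility with the relations *)
Section Compat.
Variables (R : realType) (k : nat) (A : arrangement R k).
Local Notation C := (CC R).
Local Notation point := 'rV[C]_k.
Local Notation J := (plane_index A).

Lemma lin_ext_symbol (T : finType) (phi : T -> C) (t : T) : lin_ext phi (symbol R t) = phi t.
Proof.
rewrite /lin_ext (bigD1 t) //= ffunE eqxx mul1r big1 ?addr0 // => u ut.
by rewrite ffunE (negbTE ut) mul0r.
Qed.

Lemma ffun_symbol (T : finType) (x : {ffun T -> C^o}) : x = \sum_t x t *: symbol R t.
Proof. exact: ffun_delta.
Qed.

Record OS_compatible p (phi : p.-tuple J -> C) : Prop := {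
  OS_degenerate : forall h, ~~ general_position h -> phi h = 0;
  OS_alternate : forall h (s : 'S_p), phi (permt s h) = (-1) ^+ s * phi h;
  OS_dependent : forall h : p.+1.-tuple J, ~~ general_position h ->
    zeros h !=set0 -> \sum_(j < p.+1) (-1) ^+ j.+1 * phi (omitt j h) = 0 }.

Lemma OS_compatible_rel p (phi : p.-tuple J -> C) x :
  OS_compatible phi -> x \in OSrel A p -> lin_ext phi x = 0.
Proof.
move=> phiP /memv_addP [y /memv_addP [y1 y1P [y2 y2P ->]] [y3 y3P ->]].
rewrite !lin_extD (lin_ext_sumv _ y1P) ?(lin_ext_sumv _ y2P) ?(lin_ext_sumv _ y3P) ?addr0 //.
- move=> h /andP [hg /asboolP]; rewrite inter_zeros => hn z; apply: lin_ext_line.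
  rewrite lin_ext_sum -[RHS](OS_dependent phiP hg hn); apply: eq_bigr => j _.
  by rewrite lin_extZ lin_ext_symbol.
- move=> h _ z; apply: lin_ext_sumv => s _ w; apply: lin_ext_line.
  by rewrite lin_extD lin_extN lin_extZ !lin_ext_symbol (OS_alternate phiP) subrr.
- by move=> h hg z; apply: lin_ext_line; rewrite lin_ext_symbol (OS_degenerate phiP).
Qed.

Lemma OS_compatible_repr p (phi : p.-tuple J -> C) x :
  OS_compatible phi -> lin_ext phi (repr (\pi_(OS A p) x)) = lin_ext phi x.
Proof.
move=> phiP; apply/eqP; rewrite -subr_eq0 -lin_extN -lin_extD; apply/eqP.
by apply: OS_compatible_rel => //; apply: repr_pi_mem.
Qed.

Definition flag_compatible p (psi : flag A p -> C) : Prop :=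
  forall (F : flag A p) (j : 'I_p.+1), (0 < j < p)%N ->
  \sum_(G : flag A p | [forall i, (i != j) ==> (val G i == val F i)]) psi G = 0.

Lemma flag_compatible_rel p (psi : flag A p -> C) x :
  flag_compatible psi -> x \in Frel A p -> lin_ext psi x = 0.
Proof.
move=> psiP; apply: lin_ext_sumv => F _ y; apply: lin_ext_sumv => j jp z.
apply: lin_ext_line; rewrite lin_ext_sum -[RHS](psiP F j jp).
by apply: eq_bigr => G _; rewrite lin_ext_symbol.
Qed.

Lemma flag_compatible_repr p (psi : flag A p -> C) x :
  flag_compatible psi -> lin_ext psi (repr (\pi_(FS A p) x)) = lin_ext psi x.
Proof.
move=> psiP; apply/eqP; rewrite -subr_eq0 -lin_extN -lin_extD; apply/eqP.
by apply: flag_compatible_rel => //; apply: repr_pi_mem.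
Qed.

Lemma codim_hyperplane (j : J) : has_codim (hyperplane j) 1.
Proof.
have := @row_free_codim _ _ A 1 [tuple j]; rewrite zeros1; apply.
rewrite -row_leq_rank lt0n mxrank_eq0; apply: contra_neq (normal_neq0 j).
by move/rowP => N0; apply/rowP => i; have := N0 i; rewrite !mxE.
Qed.

Lemma setT_nsub (j : J) : ~ [set: point] `<=` hyperplane j.
Proof. by move/(codim_le (codim_setT R k) (codim_hyperplane j)). Qed.

Section Pairing.
Variable p : nat.
Implicit Types (F G : flag A p) (h : p.-tuple J).

Lemma pairing_sym_neq0 h F : pairing_sym h F != 0 -> term F p = zeros h.
Proof.
rewrite pairing_sym_det => /det_entry_neq0 [s /flag_of_tupleP ->//].
by rewrite take_oversize ?size_tuple // zeros_permt.
Qed.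


(** Skew-symmetry is that of the determinant. For the remaining relation, if
    the last term of F lies in every hyperplane of H, each row of the matrix of H
    sums to 1, and the column of ones is a combination of the others. Otherwise
    some hyperplane of H cuts the last term of F properly, and a nonzero term of
    the relation would put H in general position. *)
Lemma pairing_OS_compatible F : OS_compatible (fun h => pairing_sym h F).
Proof.
split=> [h hg|h s|H Hg Hn]; first by rewrite /pairing_sym (negbTE hg).
  rewrite !pairing_sym_det (_ : entry_mx (permt s h) F = row_perm s (entry_mx h F)).
    by rewrite row_permE det_mulmx det_perm.
  by apply/matrixP => i m; rewrite !mxE tnth_permt.
have memH i j : i != j -> tnth H i \in omitt j H.
  rewrite eq_sym => /unlift_some [a -> _].
  by apply/tnthP; exists a; rewrite tnth_mktuple.
have [/forallP allH|/forallPn [i iH]] := boolP [forall i, lies_in (term F p) (tnth H i)].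
  rewrite -[RHS](@alternating_minors_col _ _
      (\matrix_(i, m) entry F (tnth H i) m) (const_mx 1)).
    apply: eq_bigr => j _; rewrite pairing_sym_det; congr (_ * _).
    by congr (\det _); apply/matrixP => i m; rewrite !mxE tnth_mktuple.
  apply/matrixP => i l; rewrite !mxE.
  rewrite (eq_bigr (fun m : 'I_p => entry F (tnth H i) m)); last first.
    by move=> m _; rewrite !mxE mulr1.
  rewrite -(big_mkord xpredT (fun m => entry F (tnth H i) m)).
  rewrite (telescope_sumr (fun m => (lies_in (term F m) (tnth H i))%:R)) // (allH i) term0.
  by rewrite (_ : lies_in setT _ = false) ?subr0 //; apply/asboolPn/setT_nsub.
rewrite big1 // => j _; have [->|pn0] := eqVneq (pairing_sym (omitt j H) F) 0.
  by rewrite mulr0.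
have Fp := pairing_sym_neq0 pn0.
have [ij|ij] := eqVneq i j; last first.
  by case/asboolP: iH; rewrite Fp; apply: zeros_hyperplane; apply: memH.
case/negP: Hg; rewrite general_positionE; apply/asboolP.
have HE : zeros H = zeros (omitt j H) `&` hyperplane (tnth H i).
  apply/seteqP; split=> [t Ht|t [Ht Ht'] e /tnthP [l ->]].
    split=> [e /tnthP [l ->]|]; last by apply: Ht; apply: mem_tnth.
    by rewrite tnth_mktuple; apply: Ht; apply: mem_tnth.
  by have [<-|li] := eqVneq i l; [|apply: Ht; apply: memH; rewrite -ij eq_sym].
rewrite HE; apply: codim_cut; rewrite -?HE // -Fp; first exact: term_codim.
exact/asboolPn.
Qed.

(** When the j-th term X of the flag varies, only the rows j-1 and j of the
    transposed matrix vary, and their sum w does not. Adding one to the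
    other replaces row j by w, so the determinant becomes linear in row j-1. The
    sum over X of the rows j-1 is again w, because a hyperplane containing the
    term j+1 but not the term j-1 contains exactly one X. The resulting matrix
    has two equal rows. *)
Lemma pairing_flag_compatible h : flag_compatible (pairing_sym h).
Proof.
move=> F j /andP [j0 jp].
have ap : (j.-1 < p)%N by apply: leq_ltn_trans jp; apply: leq_pred.
pose a := Ordinal ap; pose b := Ordinal jp.
have ab : a != b by rewrite -val_eqE /= neq_ltn prednK // leqnn.
pose w i : C := (lies_in (term F j.+1) (tnth h i))%:R - (lies_in (term F j.-1) (tnth h i))%:R.
pose E : 'M[C]_p := \matrix_(m, i) if (m == b) || (m == a) then w i else entry F (tnth h i) m.
(* E is the final matrix, with rows j-1 and j both equal to w. *)
have E0 : \det E = 0.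
  by apply: (determinant_alternate ab) => i; rewrite !mxE !eqxx orbT.
pose P G := [forall i, (i != j) ==> (val G i == val F i)].
have PE G m : P G -> (m <= p)%N -> m != j -> term G m = term F m.
  move=> /forallP /(_ (inord m)) /implyP H mp mj; rewrite /term.
  by have /eqP -> // : val G (inord m) == val F (inord m);
     apply: H; rewrite -val_eqE /= inordK.
have n1 : j.+1 != j by rewrite neq_ltn ltnSn orbT.
have n2 : j.-1 != j by rewrite neq_ltn prednK // leqnn.
have jp1 : (j.-1 <= p)%N by apply: ltnW.
have jp2 : (j <= p)%N by apply: ltnW.
have step G : P G -> pairing_sym h G =
    \sum_i entry G (tnth h i) a * cofactor E a i.
  move=> PG; rewrite pairing_sym_det -det_tr -(det_add_row _ ab).
  rewrite (expand_det_row _ a); apply: eq_bigr => i _.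
  rewrite mxE (negbTE ab) !mxE; congr (_ * (_ * \det _)).
  apply/matrixP => m l; rewrite !mxE.
  have ma : lift a m != a by rewrite eq_sym neq_lift.
  rewrite (negbTE ma) orbF; case: ifPn => mb.
    rewrite /entry /w /= prednK // [LHS]addrC addrA subrK.
    by rewrite !(PE G).
  have m1 : lift a m != j.-1 :> nat := ma.
  have m2 : (lift a m).+1 != j :> nat by apply: contraNneq m1 => <-.
  by rewrite /entry !(PE G) // ltnW.
have wE i : \sum_(G | P G) entry G (tnth h i) a = w i.
  set e := tnth h i; have [Fe|Fe] := boolP (lies_in (term F j.-1) e).
    rewrite /w -/e (_ : lies_in (term F j.+1) e); last first.
      apply/asboolP; move/asboolP: Fe; apply: subset_trans.
      by apply: term_sub; rewrite // (leq_trans (leq_pred j)).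
    by rewrite Fe subrr big1 // => G PG; rewrite entryE // (PE G j.-1) // Fe andbF.
  have entG G : P G -> entry G e a = (lies_in (term G j) e)%:R.
    by move=> PG; rewrite entryE // (PE G j.-1) // Fe /= prednK // andbT.
  rewrite (eq_bigr _ entG) /w -/e (negbTE Fe) subr0.
  have [F2|F2] := boolP (lies_in (term F j.+1) e); last first.
    rewrite big1 // => G PG; rewrite (_ : lies_in _ _ = false) //.
    apply/negP => GE; case/negP: F2; apply/asboolP; move/asboolP: GE.
    rewrite -(PE G) //; apply: subset_trans.
    exact: term_sub.
  have {}Fe : ~ term F j.-1 `<=` hyperplane e by apply/asboolPn.
  have {}F2 : term F j.+1 `<=` hyperplane e by apply/asboolP.
  have jle : (j.-1 <= j.+1)%N by apply: leq_trans (leq_pred j) _.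
  (* The only completion inside e: its j-th term is the section by e. *)
  pose X m := if m == j :> nat then term F j.-1 `&` hyperplane e else term F m.
  have cX m : (m <= p)%N -> has_codim (X m) m.
    rewrite /X; case: eqP => [-> _|_ mp]; last exact: term_codim.
    rewrite -{2}[j : nat](prednK j0); apply: codim_cut => //.
      by apply: term_codim; apply: ltnW.
    have [x Fx] := term_neq0 F j.+1; exists x; split; last exact: F2.
    exact: term_sub jle jp _ Fx.
  have sX m : (m <= p)%N -> exists s : seq J, X m = zeros s.
    rewrite /X; case: eqP => _ mp; last exact: term_zeros.
    by have [s ->] := term_zeros F j.-1; exists (rcons s e); rewrite zeros_rcons.
  have subX m : (m < p)%N -> X m.+1 `<=` X m.
    rewrite /X => mp; case: eqP => [mj|_]; case: eqP => [mj'|_].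
    - by move: mj; rewrite mj' => /eqP; rewrite eqn_leq ltnn.
    - by move=> t []; rewrite -mj.
    - rewrite mj' => t Ft; split; last exact: F2.
      exact: term_sub jle jp _ Ft.
    - exact: term_sub.
  have [G0 G0E] := flag_exists cX sX subX.
  have PG0 : P G0.
    apply/forallP => i0; apply/implyP => ij; apply/eqP/val_inj.
    have i0p : (i0 <= p)%N by rewrite -ltnS.
    have i0j : i0 != j :> nat := ij.
    rewrite -[LHS]/(fsval (val G0 i0)) -[RHS]/(fsval (val F i0)) (term_ord G0) (term_ord F).
    by rewrite (G0E _ i0p) /X (negbTE i0j).
  rewrite (bigD1 G0) //= big1 => [|G /andP [PG GG0]].
    rewrite addr0 G0E // /X eqxx (_ : lies_in _ _ = true) //.
    by apply/asboolP => t [].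
  rewrite (_ : lies_in _ _ = false) //; apply/asboolPn => Gj.
  case/eqP: GG0; apply: flag_eq => m mp; have [->|mj] := eqVneq m j.
    rewrite G0E // /X eqxx.
    have := @term_cut _ _ A p G j.-1 e ap; rewrite prednK // (PE G) //; exact.
  by rewrite (PE G) // G0E // /X (negbTE mj).
rewrite (eq_bigr _ step) exchange_big /= -[RHS]E0 (expand_det_row _ a).
by apply: eq_bigr => i _; rewrite -big_distrl /= wE mxE eqxx orbT.
Qed.
End Pairing.
End Compat.

(** * Adapted tuples and the perfect pairing *)
Section Duality.
Variables (R : realType) (k : nat) (A : arrangement R k).
Local Notation C := (CC R).
Local Notation point := 'rV[C]_k.
Local Notation J := (plane_index A).

(** A choice of one hyperplane through each stratum. It depends on the stratum
    only, not on a list of hyperplanes cutting it out. *)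
Definition wall (X : set point) : option J := [pick j : J | lies_in X j].

Lemma wallP (s : seq J) p : has_codim (zeros s) p.+1 ->
  exists j, wall (zeros s) = Some j /\ zeros s `<=` hyperplane j.
Proof.
move=> sp; rewrite /wall; case: pickP => [j /asboolP sj|no]; first by exists j.
case: s sp no => [|j s] sp no.
  by move: sp; rewrite zeros0 => /(codim_uniq (codim_setT R k)).
by have /asboolPn[] := negbT (no j); apply: zeros_hyperplane; apply: mem_head.
Qed.

Section Length.
Variable p : nat.
Implicit Types (F G : flag A p) (g h : p.-tuple J).

Definition adapted h : bool :=
  general_position h && [forall i : 'I_p, wall (zeros (take i.+1 h)) == Some (tnth h i)].

Lemma zeros_takeP h m (t : point) :
  zeros (take m h) t <-> (forall a : 'I_p, (a < m)%N -> defeq (tnth h a) t = 0).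
Proof.
split=> [ht a am|ht j].
  apply: ht; rewrite (tnth_nth (tnth_default h a)) -(nth_take _ am) mem_nth //.
  by rewrite size_take size_tuple; case: ifP.
move=> jh; have /(nthP j) [a] := jh; rewrite size_take size_tuple => ia <-.
have am : (a < m)%N by apply: leq_trans ia _; case: ltnP.
have ap : (a < p)%N by apply: leq_trans ia _; case: ltnP => // /ltnW.
by rewrite nth_take // -[a]/(val (Ordinal ap)) -tnth_nth; apply: ht.
Qed.

(** By induction on q, phi vanishes on tuples which are adapted from position q
    on. Inserting the wall c of the stratum cut out by the first q+1 hyperplanes
    after position q gives a dependent tuple with the same intersection. In its
    relation, one term is phi h; omitting a later entry keeps the dependent first
    q+2 entries; omitting an earlier one moves c to position q and changes no
    stratum after it, so the induction hypothesis applies. *)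
Lemma OS_compatible_eq0 (phi : p.-tuple J -> C) : OS_compatible phi ->
  (forall h, adapted h -> phi h = 0) -> forall h, phi h = 0.
Proof.
move=> phiP phi0 h0; case: (boolP (general_position h0)); last exact: OS_degenerate.
rewrite general_positionE => /asboolP.
suff main q : (q <= p)%N -> forall h, has_codim (zeros h) p ->
    (forall i : 'I_p, (q <= i)%N -> wall (zeros (take i.+1 h)) = Some (tnth h i)) ->
    phi h = 0.
  by move=> h0p; apply: (main p) => // i; rewrite leqNgt ltn_ord.
elim: q => [|q IH] qp h hp hgood.
  apply: phi0; rewrite /adapted general_positionE asboolT //=.
  by apply/forallP => i; apply/eqP/hgood.
have htake m : (m <= p)%N -> has_codim (zeros (take m h)) m.
  by move=> mp; apply: codim_take; rewrite size_tuple.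
have [c [cE hc]] := wallP (htake _ qp).
(* The tuple h with c inserted after position q. *)
pose f m := if (m <= q)%N then nth c h m else if m == q.+1 then c else nth c h m.-1.
have f0 i b t : (q <= i)%N -> (i < p)%N -> (b <= i.+1)%N ->
    zeros (take i.+1 h) t -> defeq (f b) t = 0.
  move=> qi ip bi /zeros_takeP it; rewrite /f; have [bq|bq] := leqP b q.
    have bp : (b < p)%N by lia.
    by rewrite -[b]/(val (Ordinal bp)) -tnth_nth; apply: it => /=; lia.
  case: eqVneq => [_|bq1]; first by apply: hc; apply/zeros_takeP => a aq; apply: it; lia.
  have bp : (b.-1 < p)%N by lia.
  by rewrite -[b.-1]/(val (Ordinal bp)) -tnth_nth; apply: it => /=; lia.
pose H : p.+1.-tuple J := [tuple f i | i < p.+1].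
have omitE (j : 'I_p.+1) (a : 'I_p) : tnth (omitt j H) a = f (bump j a).
  by rewrite !tnth_mktuple.
have lt_q : (q.+1 < p.+1)%N by [].
have omit_q : omitt (Ordinal lt_q) H = h.
  apply: eq_from_tnth => a; rewrite omitE /= /f /bump.
  case: (leqP q.+1 a) => aq /=; last by rewrite add0n -ltnS aq (tnth_nth c).
  rewrite add1n ltnNge ltnW //= eqSS gtn_eqF //= (tnth_nth c) //.
have zerosH : zeros H = zeros h.
  apply/seteqP; split; last first.
    move=> t ht j /tnthP [i ->]; rewrite tnth_mktuple.
    have ip := ltn_ord i; have pE : p.-1.+1 = p by lia.
    apply: (f0 p.-1); [lia|lia|by rewrite pE|].
    by rewrite pE take_oversize ?size_tuple.
  apply: zerosS => j /tnthP [i ->]; rewrite -omit_q tnth_mktuple.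
  exact: mem_tnth.
have Hng : ~~ general_position H.
  rewrite general_positionE zerosH; apply/asboolPn => /(codim_uniq hp).
  by move/eqP; rewrite ltn_eqF.
have Hne : zeros H !=set0 by rewrite zerosH; apply: codim_neq0 hp.
have := OS_dependent phiP Hng Hne.
rewrite (bigD1 (Ordinal lt_q)) //= omit_q big1 ?addr0 => [/eqP|j jq].
  by rewrite mulf_eq0 signr_eq0 => /eqP.
have [gj|] := boolP (general_position (omitt j H)); last first.
  by move/(OS_degenerate phiP) ->; rewrite mulr0.
have {}gj : has_codim (zeros (omitt j H)) p by move: gj; rewrite general_positionE => /asboolP.
have gtake m : (m <= p)%N -> has_codim (zeros (take m (omitt j H))) m.
  by move=> mp; apply: codim_take; rewrite size_tuple.
have {}jq : j != q.+1 :> nat := jq.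
have jp := ltn_ord j.
have [jq2|jq2] := leqP j q.+1; last first.
  suff : (q.+2 <= q.+1)%N by rewrite ltnn.
  apply: codim_le (htake _ qp) (gtake q.+2 _) _; first by lia.
  move=> t qt; apply/zeros_takeP => a aq; rewrite omitE; apply: (f0 q) => //.
  by rewrite /bump; lia.
have same i : (q <= i)%N -> (i < p)%N -> zeros (take i.+1 (omitt j H)) = zeros (take i.+1 h).
  move=> qi ip; apply/esym; apply: codim_eq (htake _ ip) (gtake _ ip) _.
  move=> t it; apply/zeros_takeP => a ai; rewrite omitE; apply: (f0 i) => //.
  by rewrite /bump; lia.
rewrite (IH _ _ gj) ?mulr0 ?(ltnW qp) // => i qi; rewrite same //.
rewrite omitE /f /bump.
have -> : (j <= i)%N by lia.
rewrite add1n ltnNge qi /= eqSS; case: eqVneq => [->|iq] //.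
by rewrite hgood -?(tnth_nth c) //; lia.
Qed.

Lemma OS_compatible_sum (I : finType) (c : I -> C) (phi : I -> p.-tuple J -> C) :
  (forall i, OS_compatible (phi i)) -> OS_compatible (fun h => \sum_i c i * phi i h).
Proof.
move=> phiP; split=> [h hg|h s|H Hg Hn].
- by rewrite big1 // => i _; rewrite (OS_degenerate (phiP i)) ?mulr0.
- rewrite big_distrr; apply: eq_bigr => i _.
  by rewrite (OS_alternate (phiP i)) mulrCA.
- under eq_bigr do rewrite big_distrr.
  rewrite exchange_big big1 //= => i _.
  transitivity (c i * \sum_(j < p.+1) (-1) ^+ j.+1 * phi i (omitt j H)).
    by rewrite big_distrr; apply: eq_bigr => j _; rewrite mulrCA.
  by rewrite (OS_dependent (phiP i)) // mulr0.
Qed.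

Lemma OS_compatible_sub (phi psi : p.-tuple J -> C) :
  OS_compatible phi -> OS_compatible psi -> OS_compatible (fun h => phi h - psi h).
Proof.
move=> phiP psiP; split=> [h hg|h s|H Hg Hn].
- by rewrite (OS_degenerate phiP) // (OS_degenerate psiP) // subrr.
- by rewrite (OS_alternate phiP) (OS_alternate psiP) mulrBr.
- under eq_bigr do rewrite mulrBr.
  by rewrite sumrB (OS_dependent phiP) // (OS_dependent psiP) // subrr.
Qed.

Lemma flag_of_tuple_inj h F G : flag_of_tuple h F -> flag_of_tuple h G -> F = G.
Proof.
move=> /flag_of_tupleP hF /flag_of_tupleP hG.
by apply: flag_eq => m mp; rewrite hF // hG.
Qed.

Lemma pairing_sym1 h F : flag_of_tuple h F -> pairing_sym h F = 1.
Proof.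
move=> hF; have h1 : permt 1 h = h by apply: eq_from_tnth => i; rewrite tnth_permt perm1.
rewrite pairing_sym_det (@entry_mx_permt _ _ _ _ _ 1) ?h1 //.
by rewrite invg1 perm_mx1 det1.
Qed.

Lemma adapted_codim h m : adapted h -> (m <= p)%N -> has_codim (zeros (take m h)) m.
Proof.
rewrite /adapted general_positionE => /andP [/asboolP hp _] mp.
by apply: codim_take; rewrite size_tuple.
Qed.

Lemma adapted_wall h (i : 'I_p) : adapted h -> wall (zeros (take i.+1 h)) = Some (tnth h i).
Proof. by move=> /andP [_ /forallP /(_ i) /eqP]. Qed.

(** Suppose that F is also the flag of a reordering of g. Descending from the
    last stratum, which is common to g and h, adaptedness makes the last
    hyperplanes of g and h equal to the wall of that stratum. This hyperplane is
    the one entered at the last step of F, so the others cut out the preceding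
    term, and the argument repeats. *)
Lemma pairing_adapted g h F : adapted g -> adapted h -> flag_of_tuple h F ->
  pairing_sym g F = (g == h)%:R.
Proof.
move=> ga ha hF; case: eqVneq => [->|gh]; first exact: pairing_sym1.
apply/eqP; apply: contraNT gh; rewrite pairing_sym_det => /det_entry_neq0 [s gF].
have hFE := elimT (flag_of_tupleP _ _) hF; have gFE := elimT (flag_of_tupleP _ _) gF.
have cut := (iffLR (flag_of_tuple_cut _ _) gF).
have step (m : 'I_p) : term F m.+1 = zeros (take m.+1 g) ->
    tnth g m = tnth h m /\ term F m = zeros (take m g).
  move=> Fm; have gm : tnth g m = tnth h m.
    by have := adapted_wall m ga; rewrite -Fm hFE // (adapted_wall m ha) => -[].
  split=> //; have sm : s m = m.
    have [sub nsub] := cut (s^-1 m)%g; rewrite tnth_permt permKV in sub nsub.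
    have [sub' nsub'] := iffLR (flag_of_tuple_cut _ _) hF m.
    rewrite -gm in sub' nsub'.
    have := entry_uniq (ltn_ord _) (ltn_ord m) sub nsub.
    rewrite (entry_uniq (ltn_ord m) (ltn_ord m) sub' nsub') eqxx.
    case: eqVneq => [/val_inj sm _|_ /eqP]; first by rewrite -{1}sm permKV.
    by rewrite oner_eq0.
  have mp := ltnW (ltn_ord m).
  apply: (codim_eq (term_codim F mp) (adapted_codim ga mp)).
  move=> t Ft; apply/zeros_takeP => a am.
  have [sub nsub] := cut (s^-1 a)%g; rewrite tnth_permt permKV in sub nsub.
  have am' : ((s^-1)%g a < m)%N.
    rewrite ltnNge; apply/negP; rewrite leq_eqVlt => /orP [/eqP/val_inj ma|ma].
      by move: am; rewrite -(permKV s a) -ma sm ltnn.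
    apply: nsub => u /(term_sub ma (ltnW (ltn_ord _))); rewrite Fm => /zeros_takeP.
    by apply; apply: ltnW.
  by apply: sub; apply: term_sub Ft.
have all m : (m <= p)%N -> term F (p - m) = zeros (take (p - m) g).
  elim: m => [|m IH] mp.
    rewrite subn0 gFE // !take_oversize ?size_tuple // zeros_permt //.
  have mp' : (p - m.+1 < p)%N by lia.
  have := step (Ordinal mp'); rewrite /= subnSK // => /(_ (IH (ltnW mp))) [] //.
apply/eqP/eq_from_tnth => i; have [] // := step i.
by have := all (p - i.+1)%N; rewrite subKn // => -> //; apply: leq_subr.
Qed.

(** The combination of the flags of adapted tuples h with coefficients phi h
    represents phi on adapted tuples, hence on all tuples. *)
Theorem OS_functional_flag (phi : p.-tuple J -> C) : OS_compatible phi ->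
  exists y : {ffun flag A p -> C^o}, forall g, lin_ext (pairing_sym g) y = phi g.
Proof.
move=> phiP.
pose y := \sum_(h | adapted h) \sum_(F | flag_of_tuple h F) phi h *: symbol R F.
have yE g : lin_ext (pairing_sym g) y =
    \sum_h \sum_(F : flag A p) (if adapted h && flag_of_tuple h F then phi h else 0) * pairing_sym g F.
  rewrite lin_ext_sum big_mkcond; apply: eq_bigr => h _; case: ifP => ha; last first.
    by rewrite big1 // => F _; rewrite mul0r.
  rewrite lin_ext_sum big_mkcond; apply: eq_bigr => F _.
  by case: ifP => hF; rewrite ?mul0r // lin_extZ lin_ext_symbol.
exists y => g; apply/esym/eqP; rewrite -subr_eq0; apply/eqP; move: g.
apply: OS_compatible_eq0.
  apply: OS_compatible_sub => //.
  rewrite (_ : (fun h => _) = fun g => \sum_F y F * pairing_sym g F) //.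
  by apply: OS_compatible_sum => F; apply: pairing_OS_compatible.
move=> g ga; apply/eqP; rewrite subr_eq0 yE; apply/eqP.
have gp : has_codim (zeros g) p by have := adapted_codim ga (leqnn p); rewrite take_oversize ?size_tuple.
have [F gF] := flag_of_tuple_exists gp.
rewrite (bigD1 g) //= [X in _ + X]big1 ?addr0 => [|h hg].
  rewrite (bigD1 F) //= ga gF pairing_sym1 // mulr1 big1 ?addr0 // => G GF.
  case: ifP => [gG|_]; last by rewrite mul0r.
  by rewrite (flag_of_tuple_inj gG gF) eqxx in GF.
rewrite big1 // => G _; case: ifP => [/andP [ha hG]|_]; last by rewrite mul0r.
by rewrite (pairing_adapted ga ha hG) eq_sym (negbTE hg) mulr0.
Qed.

End Length.
End Duality.

Section Perfect.
Variables (R : realType) (k : nat) (A : arrangement R k) (p : nat).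
Local Notation C := (CC R).
Local Notation point := 'rV[C]_k.
Local Notation J := (plane_index A).
Implicit Types (F G : flag A p) (g h : p.-tuple J).

Definition adapted_span : {vspace {ffun flag A p -> C^o}} :=
  (Frel A p + \sum_(G : flag A p | [exists h, adapted h && flag_of_tuple h G])
     <[symbol R G]>)%VS.

Definition transversal F m : Prop :=
  exists j : J, wall A (term F m.+1) = Some j /\ ~ term F m `<=` hyperplane j.

Lemma transversal_adapted F : (forall m, (m < p)%N -> transversal F m) ->
  exists h, adapted h /\ flag_of_tuple h F.
Proof.
move=> tF.
have /choice [f fP] : forall i : 'I_p, exists j : J,
    wall A (term F i.+1) = Some j /\ ~ term F i `<=` hyperplane j.
  by move=> i; apply: tF.
have hF : flag_of_tuple [tuple f i | i < p] F.
  apply/flag_of_tuple_cut => i; rewrite tnth_mktuple; have [wi ni] := fP i.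
  split=> //; move: wi; rewrite /wall; case: pickP => // j /asboolP Fj [<-] //.
exists [tuple f i | i < p]; split=> //; rewrite /adapted general_positionE.
rewrite asboolT /=; last exact: flag_of_tuple_codim hF.
apply/forallP => i; rewrite -(elimT (flag_of_tupleP _ _) hF) // tnth_mktuple.
by have [-> _] := fP i.
Qed.

Lemma wall_term F m : (m < p)%N -> exists j : J,
  wall A (term F m.+1) = Some j /\ term F m.+1 `<=` hyperplane j.
Proof.
move=> mp; have [s sE] := term_zeros F m.+1; have := term_codim F mp.
by rewrite sE => /wallP.
Qed.

(** The outer induction makes one more step of F transversal, meaning not inside
    the wall c of the next term. If step q is not, take r < q with the r-th term
    not in c. In the relation at position r+1 a single flag has its new term
    inside c, since that term is the section of the r-th term by c; so this flag
    is minus the sum of the others, for which r increases. *)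
Lemma symbol_adapted_span F : symbol R F \in adapted_span.
Proof.
suff main q : (q <= p)%N -> forall G,
    (forall m, (q <= m)%N -> (m < p)%N -> transversal G m) -> symbol R G \in adapted_span.
  by apply: (main p) => // m pm mp; move: (leq_ltn_trans pm mp); rewrite ltnn.
elim: q => [|q IH] qp {}F Fq.
  have [h [ah hF]] := transversal_adapted (fun m => Fq m (leq0n m)).
  apply: (subvP (addvSr _ _)); apply: (subvP (sumv_sup F _ (subvv _))); last exact: memv_line.
  by apply/existsP; exists h; rewrite ah.
have [c [cE cF]] := wall_term F qp.
suff main m r : (r + m)%N = q -> forall G, ~ term G r `<=` hyperplane c ->
    (forall n, (q < n)%N -> (n <= p)%N -> term G n = term F n) -> symbol R G \in adapted_span.
  by apply: (main q 0%N) => //; rewrite term0; exact: setT_nsub.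
elim: m r => [|m IHm] r rq G Gr GF.
  rewrite addn0 in rq; rewrite {}rq in Gr; apply: (IH (ltnW qp)) => n qn np.
  rewrite /transversal GF //; have [nq|nq|nq] := ltngtP n q; first by lia.
    by rewrite GF ?(ltnW np) //; apply: Fq.
  by rewrite nq; exists c.
have rq' : (r.+1 + m)%N = q by rewrite addSnnS.
have [Gr1|Gr1] := pselect (term G r.+1 `<=` hyperplane c); last exact: IHm rq' _ Gr1 GF.
have rp : (r.+1 < p.+1)%N by lia.
have r1p : (r.+1 < p)%N by lia.
pose j := Ordinal rp.
pose P G' := [forall i, (i != j) ==> (val G' i == val G i)].
have PE G' n : P G' -> (n <= p)%N -> n != r.+1 -> term G' n = term G n.
  move=> /forallP /(_ (inord n)) /implyP H np nj; rewrite /term.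
  by have /eqP -> // : val G' (inord n) == val G (inord n);
     apply: H; rewrite -val_eqE /= inordK.
have sumP : \sum_(G' | P G') symbol R G' \in adapted_span.
  apply: (subvP (addvSl _ _)); apply: (subvP (sumv_sup G _ (subvv _))) => //.
  by apply: (subvP (sumv_sup j _ (subvv _))); [|exact: memv_line].
have PG : P G by apply/forallP => i; apply/implyP.
move: sumP; rewrite (bigD1 G) //= => sumP.
rewrite -(addrK (\sum_(G' | P G' && (G' != G)) symbol R G') (symbol R G)).
apply: memvB => //; apply: memv_suml => G' /andP [PG' GG'].
apply: (IHm r.+1 rq') => [|n qn np].
  move=> Gc; case/eqP: GG'; apply: flag_eq => n np.
  have [->|nr] := eqVneq n r.+1; last exact: PE.
  have rr : r != r.+1 by rewrite neq_ltn ltnSn.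
  have rlt : (r < p)%N by lia.
  have Gr' : term G' r = term G r by apply: PE => //; apply: ltnW.
  by rewrite (term_cut rlt _ Gc) ?Gr' // (term_cut rlt Gr Gr1).
by rewrite PE ?GF //; lia.
Qed.

Lemma Frel_of_pairing0 (y : {ffun flag A p -> C^o}) :
  (forall g, lin_ext (pairing_sym g) y = 0) -> y \in Frel A p.
Proof.
move=> y0; have : y \in adapted_span.
  rewrite (ffun_symbol y); apply: memv_suml => F _.
  by apply: memvZ; apply: symbol_adapted_span.
move=> /memv_addP [u uF [v /memv_sumP [c cP vE] yE]].
have {vE} vE : v = 0.
  rewrite vE big1 // => F PF; have /existsP [h /andP [ah hF]] := PF.
  have /vlineP [x xE] := cP F PF; rewrite xE.
  suff -> : x = 0 by rewrite scale0r.
  have := y0 h; rewrite yE lin_extD (flag_compatible_rel _ uF) ?add0r; last first.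
    exact: pairing_flag_compatible.
  rewrite vE lin_ext_sum (bigD1 F) //= xE lin_extZ lin_ext_symbol pairing_sym1 // mulr1.
  rewrite big1 ?addr0 // => G /andP [PG GF].
  have /existsP [g /andP [ag gG]] := PG; have /vlineP [z ->] := cP G PG.
  rewrite lin_extZ lin_ext_symbol (pairing_adapted ah ag gG).
  case: eqVneq => [hg|]; last by rewrite mulr0.
  by move: GF; rewrite -hg in gG; rewrite (flag_of_tuple_inj gG hF) eqxx.
by rewrite yE vE addr0.
Qed.

Lemma pairingE (x : OS A p) (y : FS A p) :
  pairing x y = lin_ext (fun h => lin_ext (pairing_sym h) (repr y)) (repr x).
Proof.
rewrite /pairing /lin_ext; apply: eq_bigr => h _; rewrite big_distrr /=.
by apply: eq_bigr => F _; rewrite mulrA.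
Qed.

Lemma pairing_OS_sum_compatible (y : {ffun flag A p -> C^o}) :
  OS_compatible (fun h => lin_ext (pairing_sym h) y).
Proof. by apply: OS_compatible_sum => F; apply: pairing_OS_compatible. Qed.

Lemma pairing_OSsym h (y : FS A p) : pairing (OSsym h) y = lin_ext (pairing_sym h) (repr y).
Proof.
rewrite pairingE OS_compatible_repr ?lin_ext_symbol //.
exact: pairing_OS_sum_compatible.
Qed.

Lemma pairing_pi h (y : {ffun flag A p -> C^o}) :
  lin_ext (pairing_sym h) (repr (\pi_(FS A p) y)) = lin_ext (pairing_sym h) y.
Proof. by apply: flag_compatible_repr; apply: pairing_flag_compatible. Qed.

Theorem OS_functional_represented (phi : p.-tuple J -> C) : OS_compatible phi ->
  exists y : FS A p, forall x : OS A p, pairing x y = lin_ext phi (repr x).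
Proof.
move=> /OS_functional_flag [y yP]; exists (\pi_(FS A p) y) => x.
by rewrite pairingE; apply: eq_lin_ext => h; rewrite pairing_pi yP.
Qed.

Theorem pairing_FS_inj (y : FS A p) : (forall x : OS A p, pairing x y = 0) -> y = 0.
Proof.
move=> y0; rewrite -[y]reprK -[RHS]/(\pi_(FS A p) 0); apply/quotv_piP.
rewrite subr0; apply: Frel_of_pairing0 => g.
by rewrite -pairing_OSsym y0.
Qed.

Lemma pairing0 (x : OS A p) : pairing x 0 = 0.
Proof.
rewrite pairingE -[X in repr X]/(\pi_(FS A p) 0) (eq_lin_ext (psi := fun=> 0)).
  by rewrite /lin_ext big1 // => h _; rewrite mulr0.
by move=> h; rewrite pairing_pi lin_ext0.
Qed.

End Perfect.

(** * The Cauchy-Binet formula *)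
Section CauchyBinet.
Variables (K : comRingType) (J : finType) (k : nat).
Variables (u v : J -> 'rV[K]_k).
Implicit Types (g h : k.-tuple J).

Lemma det_sum_tuples :
  \det (\matrix_(i, l) \sum_j u j 0 i * v j 0 l) =
  \sum_h (\prod_i u (tnth h i) 0 i) * \det (tuple_rows v h).
Proof.
rewrite (reindex (fun f : {ffun 'I_k -> J} => [tuple f i | i < k])); last first.
  exists (fun h => [ffun i => tnth h i]) => [f _|h _].
    by apply/ffunP => i; rewrite ffunE tnth_mktuple.
  by apply: eq_from_tnth => i; rewrite tnth_mktuple ffunE.
rewrite /determinant.
under [RHS]eq_bigr do rewrite big_distrr /=.
rewrite exchange_big; apply: eq_bigr => s _ /=.
under eq_bigr do rewrite mxE.
rewrite bigA_distr_bigA big_distrr; apply: eq_bigr => f _ /=.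
rewrite mulrCA; congr (_ * _).
rewrite -big_split /=; apply: eq_bigr => i _.
by rewrite !mxE tnth_mktuple.
Qed.

Definition ptuple (h : k.-tuple J) (s : 'S_k) : k.-tuple J := [tuple tnth h (s i) | i < k].

Lemma det_ptuple (w : J -> 'rV[K]_k) h s :
  \det (tuple_rows w (ptuple h s)) = (-1) ^+ s * \det (tuple_rows w h).
Proof.
rewrite -det_perm -det_mulmx -row_permE; congr (\det _).
by apply/matrixP => i l; rewrite !mxE tnth_mktuple.
Qed.

Lemma det_tuple_notuniq (w : J -> 'rV[K]_k) h : ~~ uniq h -> \det (tuple_rows w h) = 0.
Proof.
move=> /tuple_uniqP hn; have /existsP [a /existsP [b /andP [ab /eqP hab]]] :
    [exists a, exists b, (a != b) && (tnth h a == tnth h b)].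
  apply: contra_notT hn => /existsPn H a b hab; apply/eqP; apply: contraT => ab.
  by have /existsPn /(_ b) := H a; rewrite ab hab eqxx.
by apply: (determinant_alternate ab) => l; rewrite !mxE hab.
Qed.

(** The enumerations of subsets, one for each subset. *)
Definition standard h := val h == enum [set j in h].

Lemma uniq_standard h : uniq h -> exists g s, standard g /\ h = ptuple g s.
Proof.
move=> uh; have sz : size (enum [set j in h]) == k.
  by rewrite -cardE cardsE (card_uniqP uh) size_tuple.
pose g : k.-tuple J := Tuple sz.
have gh : g =i h by move=> j; rewrite mem_enum inE.
have /tuple_permP [s hs] : perm_eq h g.
  by apply: uniq_perm => //; rewrite ?enum_uniq // => j; rewrite gh.
exists g, s; split; last exact: val_inj hs.
by rewrite /standard /=; apply/eqP/eq_enum => j; rewrite !inE gh.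
Qed.

Lemma standard_uniq h : standard h -> uniq h.
Proof. by move=> /eqP; rewrite /= => ->; apply: enum_uniq. Qed.

Lemma ptuple_uniq g s : uniq (ptuple g s) = uniq g.
Proof.
suff : perm_eq (ptuple g s) g by move/perm_uniq.
by apply/tuple_permP; exists s.
Qed.

Lemma standard_ptuple_inj g1 s1 g2 s2 : standard g1 -> standard g2 ->
  ptuple g1 s1 = ptuple g2 s2 -> g1 = g2 /\ s1 = s2.
Proof.
move=> st1 st2 e; have mem g s : ptuple g s =i g.
  by apply/perm_mem/tuple_permP; exists s.
have g12 : g1 = g2.
  apply/val_inj; rewrite (eqP st1) (eqP st2); apply: eq_enum => j.
  by rewrite !inE -(mem g1 s1) e mem.
split=> //; apply/permP => i; have /tuple_uniqP := standard_uniq st2; apply.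
by have := congr1 (fun h : k.-tuple J => tnth h i) e; rewrite !tnth_mktuple g12.
Qed.

(** The expansion by multilinearity runs over all tuples. Those with a repeated
    entry contribute zero; every other one is a unique reordering of a unique
    standard tuple g, and the sum over the reorderings of g rebuilds the
    determinant of the rows of u. *)
Theorem Cauchy_Binet :
  \det (\matrix_(i, l) \sum_j u j 0 i * v j 0 l) =
  \sum_(h | standard h) \det (tuple_rows u h) * \det (tuple_rows v h).
Proof.
rewrite det_sum_tuples.
transitivity (\sum_(h : k.-tuple J | uniq h) (\prod_i u (tnth h i) 0 i) * \det (tuple_rows v h)).
  rewrite [LHS](bigID (fun h : k.-tuple J => uniq h)) /= [X in _ + X]big1 ?addr0 // => h hu.
  by rewrite det_tuple_notuniq ?mulr0.
pose T h := (\prod_i u (tnth h i) 0 i) * \det (tuple_rows v h).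
transitivity (\sum_(h : k.-tuple J | uniq h) \sum_(gs : k.-tuple J * 'S_k |
    standard gs.1 && (ptuple gs.1 gs.2 == h)) T h).
  apply: eq_bigr => h /uniq_standard [g [s [sg hE]]].
  rewrite (big_pred1 (g, s)) // => -[g' s'] /=; apply/andP/eqP => [[sg' /eqP e]|[-> ->]].
    by rewrite hE in e; have [-> ->] := standard_ptuple_inj sg' sg e.
  by rewrite hE.
rewrite (exchange_big_dep (fun gs => standard gs.1)) /=; last by move=> h gs _ /andP [].
transitivity (\sum_(gs : k.-tuple J * 'S_k | standard gs.1) T (ptuple gs.1 gs.2)).
  apply: eq_bigr => -[g s] /= sg; rewrite (big_pred1 (ptuple g s)) // => h.
  rewrite sg /= [RHS]eq_sym; case: eqP => [<-|]; rewrite ?andbF ?andbT //.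
  by rewrite ptuple_uniq standard_uniq.
transitivity (\sum_(g | standard g) \sum_s T (ptuple g s)).
  by rewrite pair_big_dep; apply: eq_bigl => gs; rewrite andbT.
apply: eq_bigr => g _; rewrite -[\det (tuple_rows u g)]det_tr /(\det (_^T)) mulr_suml.
apply: eq_bigr => s _; rewrite /T det_ptuple mulrCA mulrA; congr (_ * _ * _).
by apply: eq_bigr => i _; rewrite !mxE tnth_mktuple.
Qed.
End CauchyBinet.

(** * Special vectors, the Shapovalov form and the Hessian *)
Section Forms.
Variables (R : realType) (k : nat) (A : arrangement R k).
Local Notation C := (CC R).
Local Notation point := 'rV[C]_k.
Local Notation J := (plane_index A).

Definition pair_normal (j : J) (w : point) : C := (w *m (normal j)^T) 0 0.

Lemma is_derive_defeq (j : J) (t w : point) : is_derive t w (defeq j) (pair_normal j w).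
Proof.
have H : (fun h : C => h^-1 *: ((defeq j \o shift t) (h *: w) - defeq j t)) @ 0^' --> pair_normal j w.
  apply: cvg_near_cst; near=> h.
  have h0 : h != 0 by near: h; exact: nbhs_dnbhs_neq.
  rewrite /= [h *: w + t]addrC defeqD addrAC subrr add0r -scalemxAl mxE.
  by rewrite [LHS]mulrA mulVf // mul1r.
apply: DeriveDef; first by apply/cvg_ex; exists (pair_normal j w).
exact: cvg_lim H.
Unshelve. all: by end_near.
Qed.

Lemma complementP (t : point) : complement A t -> forall j : J, defeq j t != 0.
Proof. by move=> ct j; apply/eqP => jt; apply: ct; exists j. Qed.

(** The coefficients of the form df_j / f_j at t. *)
Definition dlogv (t : point) (j : J) : point := (defeq j t)^-1 *: normal j.
Local Notation logs t := (tuple_rows (dlogv t)).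

Lemma dlogE (j : J) (t w : point) : dlog j t w = (dlogv t j *m w^T) 0 0.
Proof.
rewrite /dlog /dlogv (@derive_val _ _ _ _ _ _ _ (is_derive_defeq j t w)).
rewrite -scalemxAl mxE /pair_normal mulrC; congr (_ * _).
by rewrite !mxE; apply: eq_bigr => i _; rewrite !mxE mulrC.
Qed.

Lemma wedge_dlog p (h : p.-tuple J) t (W : 'M[C]_(p, k)) :
  wedge (fun i => dlog (tnth h i) t) W = \det (logs t h *m W^T).
Proof.
congr (\det _); apply/matrixP => i l; rewrite mxE dlogE !mxE.
by apply: eq_bigr => m _; rewrite !mxE.
Qed.

Lemma degenerate_normals p (h : p.-tuple J) : ~~ general_position h ->
  exists2 c : 'rV[C]_p, c != 0 & c *m tuple_rows (@normal R k A) h = 0.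
Proof.
rewrite general_positionE => /asboolPn hg.
have : ~~ row_free (tuple_rows (@normal R k A) h).
  by apply/negP => /row_free_codim.
rewrite -kermx_eq0 => /rowV0Pn [c /sub_kermxP c0 cn]; by exists c.
Qed.

Lemma logs_relation p (h : p.-tuple J) t (c : 'rV[C]_p) : complement A t ->
  (\row_i (c 0 i * defeq (tnth h i) t)) *m logs t h = c *m tuple_rows (@normal R k A) h.
Proof.
move=> /complementP ct; apply/rowP => l; rewrite !mxE; apply: eq_bigr => i _.
by rewrite !mxE mulrA mulfK.
Qed.

Lemma logs_relation_neq0 p (h : p.-tuple J) t (c : 'rV[C]_p) : complement A t ->
  c != 0 -> \row_i (c 0 i * defeq (tnth h i) t) != 0.
Proof.
move=> /complementP ct; apply: contra_neq => /rowP d0; apply/rowP => i.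
by have /eqP := d0 i; rewrite !mxE mulf_eq0 (negbTE (ct _)) orbF => /eqP.
Qed.

(** A dependency c among the normals becomes the dependency (c_i f_i(t)) among
    the rows n_i / f_i(t). If the hyperplanes meet at x, then moreover
    sum_i c_i f_i(t) = sum_i c_i n_i (t - x) = 0, so the column of ones is
    subject to the same dependency. *)
Lemma forms_OS_compatible p t (W : 'M[C]_(k, p)) : complement A t ->
  OS_compatible (fun h : p.-tuple J => \det (logs t h *m W)).
Proof.
move=> ct; split=> [h hg|h s|H Hg [x Hx]].
- have [c cn c0] := degenerate_normals hg; apply/eqP/det0P.
  exists (\row_i (c 0 i * defeq (tnth h i) t)); first exact: logs_relation_neq0.
  by rewrite mulmxA logs_relation // c0 mul0mx.
- rewrite -det_perm -det_mulmx mulmxA -row_permE; congr (\det (_ *m _)).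
  by apply/matrixP => i l; rewrite !mxE tnth_permt.
have [c cn c0] := degenerate_normals Hg.
rewrite -[RHS](@alternating_minors_row _ _ (logs t H *m W)
    (\row_i (c 0 i * defeq (tnth H i) t))).
- apply: eq_bigr => j _; congr (_ * _); congr (\det _).
  rewrite -[RHS]mul_rowsub_mx; congr (_ *m _).
  by apply/matrixP => i l; rewrite !mxE tnth_mktuple.
- exact: logs_relation_neq0.
- by rewrite mulmxA logs_relation // c0 mul0mx.
have cH (i : 'I_p.+1) : c 0 i * defeq (tnth H i) t =
    c 0 i * (normal (tnth H i) *m (t - x)^T) 0 0.
  congr (_ * _); have := defeqD (tnth H i) x (t - x).
  rewrite addrC subrK Hx ?mem_tnth // add0r => ->.
  by rewrite !mxE; apply: eq_bigr => l _; rewrite !mxE mulrC.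
under eq_bigr do rewrite mxE cH.
rewrite -[RHS](_ : (c *m tuple_rows (@normal R k A) H *m (t - x)^T) 0 0 = 0); last first.
  by rewrite c0 mul0mx mxE.
rewrite -mulmxA mxE; apply: eq_bigr => i _; congr (_ * _).
by rewrite !mxE; apply: eq_bigr => l _; rewrite !mxE.
Qed.

Lemma dvolE (W : 'M[C]_k) : dvol W = \det W^T.
Proof. by congr (\det _); apply/matrixP => i l; rewrite !mxE. Qed.

Lemma specialP t : complement A t ->
  forall x : OS A k, pairing x (special A t) = lin_ext (fun h => \det (logs t h)) (repr x).
Proof.
move=> ct x; pose P := [set y : FS A k | forall (x : OS A k) (W : 'M[C]_(k, k)),
    OSform x t W = pairing x y * dvol W].
have OSformE (z : OS A k) (W : 'M[C]_k) :
    OSform z t W = lin_ext (fun h => \det (logs t h)) (repr z) * dvol W.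
  rewrite /OSform /lin_ext mulr_suml; apply: eq_bigr => h _.
  by rewrite wedge_dlog det_mulmx dvolE mulrA.
have [y yP] : exists y : FS A k, forall x : OS A k,
    pairing x y = lin_ext (fun h => \det (logs t h)) (repr x).
  have /OS_functional_represented [y yP] := forms_OS_compatible 1%:M ct.
  by exists y => z; rewrite yP; apply: eq_lin_ext => h; rewrite mulmx1.
have /(_ x 1%:M) : P (special A t).
  by apply: xgetPex; exists y => z W; rewrite OSformE yP.
by rewrite OSformE dvolE trmx1 det1 !mulr1.
Qed.

Lemma pairing_special t (h : k.-tuple J) : complement A t ->
  pairing (OSsym h) (special A t) = \det (logs t h).
Proof.
move=> ct; rewrite specialP // OS_compatible_repr ?lin_ext_symbol //.
rewrite (_ : (fun h => _) = fun h : k.-tuple J => \det (logs t h *m 1%:M)).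
  exact: forms_OS_compatible.
by apply: funext => g; rewrite mulmx1.
Qed.

Variable a : J -> C.

Definition gram (t1 t2 : point) : 'M[C]_k :=
  \matrix_(i, l) \sum_j (a j *: dlogv t1 j) 0 i * dlogv t2 j 0 l.

Lemma shapovalov_special t1 t2 : complement A t1 -> complement A t2 ->
  shapovalov a (special A t1) (special A t2) = \det (gram t1 t2).
Proof.
move=> ct1 ct2; rewrite Cauchy_Binet; apply: eq_bigr => h _.
rewrite [X in _ * X * _](pairing_special h ct1) [X in _ * X](pairing_special h ct2).
congr (_ * _).
have -> : tuple_rows (fun j => a j *: dlogv t1 j) h =
    diag_mx (\row_i a (tnth h i)) *m logs t1 h.
  by apply/matrixP => i l; rewrite mul_diag_mx !mxE.
rewrite det_mulmx det_diag; congr (_ * _).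
by rewrite big_tuple; apply: eq_bigr => i _; rewrite mxE.
Qed.

(** The coefficients of omega(a) at t, that is the gradient of ln Phi. *)
Definition logform (t : point) : point := \sum_j a j *: dlogv t j.

Lemma dlnPhiE i t : dlnPhi a i t = logform t 0 i.
Proof.
rewrite /dlnPhi /logform summxE; apply: eq_bigr => j _.
rewrite (@derive_val _ _ _ _ _ _ _ (is_derive_defeq j t _)) /pair_normal !mxE.
rewrite (bigD1 i) //= big1 => [|l li]; last by rewrite !mxE (negbTE li) mul0r.
by rewrite !mxE !eqxx mul1r addr0 mulrCA [normal j 0 i * _]mulrC.
Qed.

Lemma criticalP t : critical a t <-> complement A t /\ logform t = 0.
Proof.
split=> [[ct crit]|[ct l0]]; split=> //.
  by apply/rowP => i; rewrite -dlnPhiE crit mxE.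
by move=> i; rewrite dlnPhiE l0 mxE.
Qed.

Lemma gram_critical t1 t2 : complement A t1 -> complement A t2 ->
  (t2 - t1) *m gram t1 t2 = logform t1 - logform t2.
Proof.
move=> /complementP c1 /complementP c2; apply/rowP => l.
rewrite /logform -sumrB summxE mxE.
under eq_bigr do rewrite [gram _ _ _ _]mxE big_distrr /=.
rewrite exchange_big; apply: eq_bigr => j _ /=; rewrite !mxE.
transitivity ((\sum_i (t2 - t1) 0 i * normal j 0 i) *
   (a j * (defeq j t1)^-1 * (defeq j t2)^-1 * normal j 0 l)).
  by rewrite mulr_suml; apply: eq_bigr => i _; rewrite !mxE; ring.
have -> : \sum_i (t2 - t1) 0 i * normal j 0 i = defeq j t2 - defeq j t1.
  have := defeqD j t1 (t2 - t1); rewrite addrC subrK => ->.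
  by rewrite addrAC subrr add0r mxE; apply: eq_bigr => i _; rewrite !mxE.
by field; rewrite c1 c2.
Qed.

Lemma is_derive_sumf (I : Type) (r : seq I) (f : I -> point -> C) (df : I -> C) t w :
  (forall i, is_derive t w (f i) (df i)) ->
  is_derive t w (fun s => \sum_(i <- r) f i s) (\sum_(i <- r) df i).
Proof.
move=> fP; elim: r => [|i r IH].
  rewrite big_nil (_ : (fun _ => _) = cst 0); first exact: is_derive_cst.
  by apply: funext => s; rewrite big_nil.
rewrite big_cons (_ : (fun _ => _) = f i + fun s => \sum_(l <- r) f l s).
  exact: is_deriveD.
by apply: funext => s; rewrite big_cons.
Qed.

Lemma hessianE t : complement A t -> hessian a t = (-1) ^+ k * \det (gram t t).
Proof.
move=> /complementP ct; rewrite -detZ; congr (\det _).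
apply/matrixP => i l; rewrite !mxE.
have -> : dlnPhi a l = fun s => \sum_j (a j * normal j 0 l) * (defeq j s)^-1.
  apply: funext => s; rewrite dlnPhiE summxE; apply: eq_bigr => j _.
  by rewrite !mxE; ring.
pose df j := (a j * normal j 0 l) * (- (defeq j t) ^- 2 * normal j 0 i).
have dP j : is_derive t (unitv R i) (fun s => (a j * normal j 0 l) * (defeq j s)^-1) (df j).
  have dj := is_derive_defeq j t (unitv R i).
  have nj : pair_normal j (unitv R i) = normal j 0 i.
    rewrite /pair_normal mxE (bigD1 i) //= big1 => [|m mi].
      by rewrite !mxE !eqxx mul1r addr0.
    by rewrite !mxE (negbTE mi) mul0r.
  have dV : is_derive t (unitv R i) (fun s => (defeq j s)^-1)
      (- (defeq j t) ^- 2 * normal j 0 i).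
    apply: DeriveDef; first by apply: derivableV; [exact: ct|exact: ex_derive].
    by rewrite deriveV ?ct //; rewrite ?derive_val ?nj.
  exact: is_deriveZ.
rewrite (@derive_val _ _ _ _ _ _ _ (is_derive_sumf _ dP)) big_distrr /=.
by apply: eq_bigr => j _; rewrite /df !mxE; field; rewrite ct.
Qed.

End Forms.

(** * Singular vectors *)
Section VertexBasis.
Variables (R : realType) (k : nat) (A : arrangement R k).
Local Notation C := (CC R).
Local Notation point := 'rV[C]_k.
Local Notation J := (plane_index A).

(** If the normals did not span, a vertex could be translated in a direction
    killed by all of them. *)
Lemma vertex_independent_normals : has_vertex A ->
  exists h : k.-tuple J, \det (tuple_rows (@normal R k A) h) != 0.
Proof.
move=> [X [x0 [D [XE dD]]]].
have D0 : D = 0%VS by apply/eqP; rewrite -dimv_eq0; apply/eqP; lia.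
have {dD} X1 t : fsval X t -> t = x0.
  by rewrite XE D0 => -[u /=]; rewrite memv0 => /eqP -> <-; rewrite addr0.
have /stratumP [[x Xx] [s sE]] := valP X.
pose N : 'M[C]_(#|J|, k) := \matrix_i normal (enum_val i).
have fN : row_full N.
  rewrite -[row_full N]/(\rank N == k) -mxrank_tr -[_ == k]/(row_free N^T) -kermx_eq0.
  apply/eqP; apply/eqP; rewrite -[_ == 0]negbK; apply/negP => /rowV0Pn [w /sub_kermxP wN].
  case/negP; have xw : fsval X (x + w).
    move: Xx; rewrite -[fsval X]/(\val X) sE => xs j js; rewrite defeqD xs // add0r.
    have := congr1 (fun M : 'rV_#|J| => M 0 (enum_rank j)) wN; rewrite !mxE => e.
    by rewrite -[RHS]e; apply: eq_bigr => l _; rewrite !mxE enum_rankK.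
  by have := X1 _ xw; rewrite (X1 _ Xx) => /eqP; rewrite -subr_eq0 addrAC subrr add0r.
exists [tuple enum_val (fullrankfun fN i) | i < k].
have := fullrowsub_full fN; rewrite row_full_unit unitmxE unitfE.
rewrite (_ : rowsub _ N = tuple_rows (@normal R k A) [tuple enum_val (fullrankfun fN i) | i < k]) //.
by apply/matrixP => i l; rewrite !mxE tnth_mktuple.
Qed.

Lemma vertex_independent_logs t : has_vertex A -> complement A t ->
  exists h : k.-tuple J, \det (tuple_rows (dlogv t) h) != 0.
Proof.
move=> /vertex_independent_normals [h hN] /complementP ct; exists h.
have -> : tuple_rows (dlogv t) h =
    diag_mx (\row_i (defeq (tnth h i) t)^-1) *m tuple_rows (@normal R k A) h.
  by apply/matrixP => i l; rewrite mul_diag_mx !mxE.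
rewrite det_mulmx det_diag mulf_neq0 //; apply/prodf_neq0 => i _.
by rewrite mxE invr_eq0.
Qed.
End VertexBasis.

Section OSlinear.
Variables (R : realType) (k : nat) (A : arrangement R k) (p : nat).
Local Notation C := (CC R).
Local Notation J := (plane_index A).
Variable phi : p.-tuple J -> C.
Hypothesis phiP : OS_compatible phi.

Lemma lin_ext_reprD (x y : OS A p) :
  lin_ext phi (repr (x + y)) = lin_ext phi (repr x) + lin_ext phi (repr y).
Proof. by rewrite -lin_extD -(OS_compatible_repr (repr x + repr y) phiP). Qed.

Lemma lin_ext_reprZ c (x : OS A p) : lin_ext phi (repr (c *: x)) = c * lin_ext phi (repr x).
Proof. by rewrite -lin_extZ -(OS_compatible_repr (c *: repr x) phiP). Qed.

Lemma lin_ext_repr0 : lin_ext phi (repr (0 : OS A p)) = 0.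
Proof. by rewrite -[RHS](lin_ext0 phi) -(OS_compatible_repr 0 phiP). Qed.

Lemma lin_ext_repr_sum (I : finType) (x : I -> OS A p) :
  lin_ext phi (repr (\sum_i x i)) = \sum_i lin_ext phi (repr (x i)).
Proof.
by elim/big_rec2: _ => [|i y z _ <-]; [exact: lin_ext_repr0|exact: lin_ext_reprD].
Qed.

Lemma lin_ext_OSsym h : lin_ext phi (repr (OSsym h)) = phi h.
Proof. by rewrite OS_compatible_repr // lin_ext_symbol. Qed.
End OSlinear.

Section Singular.
Variables (R : realType) (p : nat) (A : arrangement R p.+1).
Local Notation C := (CC R).
Local Notation point := 'rV[C]_p.+1.
Local Notation J := (plane_index A).
Local Notation logs t := (tuple_rows (dlogv t)).
Variables (a : J -> C) (t : point).
Hypothesis ct : complement A t.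

(** The coefficient of omega(a) /\ g at t, expanded along omega(a). *)
Definition contraction (g : p.-tuple J) : C :=
  \sum_l logform a t 0 l * ((-1) ^+ l * \det (col' l (logs t g))).

Lemma contraction_compatible : OS_compatible contraction.
Proof.
rewrite (_ : contraction = fun g => \sum_l (logform a t 0 l * (-1) ^+ l) *
    \det (logs t g *m col' l 1%:M)).
  by apply: OS_compatible_sum => l; apply: forms_OS_compatible.
apply: funext => g; apply: eq_bigr => l _; rewrite mulrA; congr (_ * \det _).
apply/matrixP => b c; rewrite mxE [RHS]mxE (bigD1 (lift l c)) //= !mxE eqxx mulr1.
by rewrite big1 ?addr0 // => m ml; rewrite !mxE (negbTE ml) mulr0.
Qed.

Lemma omega_form l : lin_ext (fun h : 1.-tuple J => dlogv t (tnth h 0) 0 l) (repr (omega a)) =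
  logform a t 0 l.
Proof.
have compat : OS_compatible (fun h : 1.-tuple J => dlogv t (tnth h 0) 0 l).
  rewrite (_ : (fun h => _) = fun h : 1.-tuple J => \det (logs t h *m (delta_mx l 0))).
    exact: forms_OS_compatible.
  by apply: funext => h; rewrite det_mx11 -colE !mxE.
rewrite (lin_ext_repr_sum compat) /logform summxE; apply: eq_bigr => j _.
by rewrite (lin_ext_reprZ compat) (lin_ext_OSsym compat) [RHS]mxE.
Qed.

Lemma special_dOS (x : OS A p) :
  pairing (dOS a x) (special A t) = lin_ext contraction (repr x).
Proof.
have compat : OS_compatible (fun h : p.+1.-tuple J => \det (logs t h)).
  rewrite (_ : (fun h => _) = fun h : p.+1.-tuple J => \det (logs t h *m 1%:M)).
    exact: forms_OS_compatible.
  by apply: funext => h; rewrite mulmx1.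
rewrite specialP // /dOS /OSmul (lin_ext_repr_sum compat).
under eq_bigr do rewrite (lin_ext_repr_sum compat).
rewrite exchange_big; apply: eq_bigr => g _ /=.
rewrite /contraction big_distrr /=.
under [RHS]eq_bigr do rewrite -omega_form /lin_ext.
transitivity (\sum_h repr x g * \sum_l repr (omega a) h * dlogv t (tnth h 0) 0 l *
  ((-1) ^+ l * \det (col' l (logs t g)))).
  apply: eq_bigr => h _; rewrite (lin_ext_reprZ compat) (lin_ext_OSsym compat).
  rewrite mulrAC [RHS]mulrC; congr (_ * _).
  rewrite (expand_det_row _ 0) big_distrr; apply: eq_bigr => l _.
  rewrite [LHS]mulrA /cofactor add0n; congr (_ * _ * (_ * _)).
    rewrite [LHS]mxE; congr (dlogv t _ 0 l).
    by rewrite -(tnth_lshift h g); congr (tnth _ _); apply: val_inj.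
  congr (\det _); apply/matrixP => b c; rewrite [LHS]mxE [LHS]mxE [LHS]mxE [RHS]mxE [RHS]mxE.
  apply: (congr1 (fun j => dlogv t j 0 (lift l c))).
  by rewrite -(tnth_rshift h g); congr (tnth _ _); apply: val_inj.
rewrite -big_distrr /= exchange_big big_distrr; apply: eq_bigr => l _ /=.
by rewrite mulr_suml.
Qed.

(** Let B be the invertible matrix of k independent forms omega_1, ..., omega_k.
    Pairing omega(a) with the products of k-1 of them computes, up to sign, the
    entries of omega(a) times the adjugate of B. *)
Lemma contraction_eq0 : has_vertex A -> (forall g, contraction g = 0) -> logform a t = 0.
Proof.
move=> vA c0; have [h hN] := vertex_independent_logs vA ct.
have adj0 : logform a t *m \adj (logs t h) = 0.
  apply/rowP => i; rewrite !mxE.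
  transitivity ((-1) ^+ i * contraction (omitt i h)); last by rewrite c0 mulr0.
  rewrite big_distrr; apply: eq_bigr => l _; rewrite mxE /cofactor exprD.
  rewrite (_ : row' i (col' l (logs t h)) = col' l (logs t (omitt i h))) /=; first by ring.
  by apply/matrixP => b c; rewrite !mxE tnth_mktuple.
have := congr1 (mulmx^~ (logs t h)) adj0.
rewrite -mulmxA mul_adj_mx mul0mx mul_mx_scalar => /eqP.
by rewrite scaler_eq0 (negbTE hN) => /eqP.
Qed.

Lemma deltaF_special : has_vertex A ->
  deltaF a (special A t) = 0 <-> logform a t = 0.
Proof.
move=> vA.
pose P := [set y : FS A p | forall eta : OS A p,
    pairing eta y = pairing (dOS a eta) (special A t)].
have [y Py] : exists y : FS A p, P y.
  have [y yP] := OS_functional_represented contraction_compatible.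
  by exists y => eta; rewrite yP special_dOS.
have dP : P (deltaF a (special A t)) by apply: xgetPex; exists y.
split=> [d0|l0].
  apply: contraction_eq0 => // g; have := dP (OSsym g).
  by rewrite d0 pairing0 special_dOS (lin_ext_OSsym contraction_compatible).
apply: pairing_FS_inj => x; rewrite dP special_dOS /lin_ext big1 // => g _.
by rewrite /contraction big1 ?mulr0 // => l _; rewrite l0 mxE mul0r.
Qed.
End Singular.

Theorem theorem3p1 (R : realType) (k : nat) (A : arrangement R k)
    (a : plane_index A -> CC R) (vertexA : has_vertex A) :
  [/\ forall t : 'rV[CC R]_k, complement A t ->
        (critical a t <-> singular a (special A t)),
      forall t : 'rV[CC R]_k, complement A t ->
        shapovalov a (special A t) (special A t) = (-1) ^+ k * hessian a t
    & forall t1 t2 : 'rV[CC R]_k,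
        isolated (critical a) t1 -> isolated (critical a) t2 -> t1 <> t2 ->
        shapovalov a (special A t1) (special A t2) = 0].
Proof.
split=> [t ct|t ct|t1 t2 /isolatedS /criticalP [c1 l1] /isolatedS /criticalP [c2 l2] t12].
- rewrite criticalP; case: k A a vertexA t ct => [|p] A a vA t ct.
    by split=> // _; split=> //; apply/rowP => -[].
  by rewrite -[singular _ _]/(deltaF a (special A t) = 0) deltaF_special //; split=> [[]|].
- by rewrite shapovalov_special // hessianE // mulrA -expr2 sqrr_sign mul1r.
rewrite shapovalov_special //; apply/eqP/det0P; exists (t2 - t1).
  by rewrite subr_eq0 eq_sym; apply/eqP.
by rewrite gram_critical // l1 l2 subrr.
Qed.
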